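(* Let $T$ be an infinite, locally finite tree. If $T$ is transient, then homomorphisms on $T$ are localized; if $T$ is not transient (i.e. $T$ is recurrent), then homomorphisms on $T$ are delocalized.
   Context: Trees are connected. A tree is transient (recurrent) if the simple random walk on it is transient (recurrent). A homomorphism on a graph $G$ is a function $\phi:V(G)\to\mathbb{Z}$ with $|\phi(u)-\phi(v)|=1$ for every edge $(u,v)$ of $G$. Zero boundary conditions: fix a vertex $v^*\in V(T)$. For a finite connected set $\Lambda\subset V(T)$ containing $v^*$, let $\partial\Lambda$ be the set of vertices outside $\Lambda$ adjacent to a vertex of $\Lambda$. Call $\Lambda$ admissible if the distances from $v^*$ to the vertices of $\partial\Lambda$ all have the same parity. For admissible $\Lambda$, let $\phi_\Lambda$ be uniformly chosen among the (finitely many, at least one) homomorphisms on the subtree induced on $\Lambda\cup\partial\Lambda$ that equal $0$ on $\partial\Lambda$. Homomorphisms on $T$ are localized if for every $v^*\in V(T)$ the family of laws of $\phi_\Lambda(v^* )$, over all admissible $\Lambda\ni v^*$, is tight. They are delocalized if for every $v^*\in V(T)$ and every $A>0$, $\mathbb{P}(|\phi_\Lambda(v^* )|\le A)\to 0$ as the distance from $v^*$ to $\partial\Lambda$ tends to infinity (that is, for every $\varepsilon>0$ there is $n$ such that this probability is less than $\varepsilon$ for every admissible $\Lambda\ni v^*$ with $\mathrm{dist}(v^*,\partial\Lambda)\ge n$). *)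

(* Defs.v *)
From HB Require Import structures.
From mathcomp Require Export all_boot all_order all_algebra.
From mathcomp Require Export finmap.
From mathcomp Require Export all_classical all_reals all_analysis.

Set Implicit Arguments.
Unset Strict Implicit.
Unset Printing Implicit Defensive.

Import Order.TTheory GRing.Theory Num.Theory.
Import numFieldNormedType.Exports.

Local Open Scope classical_set_scope.
Local Open Scope ring_scope.

Section Graph.
Context {V : choiceType}.
Variable e : rel V.

Definition is_graph : Prop := symmetric e /\ irreflexive e.

Definition connected_graph : Prop :=
  forall x y : V, exists p : seq V, path e x p /\ last x p = y.

Definition acyclic : Prop := forall c : seq V, ucycle e c -> (size c < 3)%N.

Definition is_tree : Prop := [/\ is_graph, connected_graph & acyclic].

Definition locally_finite : Prop := forall x : V, finite_set [set y | e x y].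

(* [fset_set A] is the finite set [A] when [A] is finite, and empty otherwise;
   [nbrs] and [boundary] are thus meaningful for locally finite graphs. *)
Definition nbrs (x : V) : {fset V} := fset_set [set y | e x y].

Definition boundary (L : {fset V}) : {fset V} :=
  fset_set [set y | y \notin L /\ exists2 x, x \in L & e x y].

Definition walk_length (x y : V) (n : nat) : Prop :=
  exists p : seq V, [/\ path e x p, last x p = y & size p = n].

(* The default value 0 is used only if [x] and [y] are not connected. *)
Definition dist (x y : V) : nat :=
  xget 0%N [set n | walk_length x y n /\
                    forall m, walk_length x y m -> (n <= m)%N].

Definition connected_in (L : {fset V}) : Prop :=
  forall x y : V, x \in L -> y \in L ->
  exists p : seq V, [/\ path e x p, last x p = y & all (mem L) p].

Definition admissible (v : V) (L : {fset V}) : Prop :=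
  [/\ v \in L, connected_in L &
      forall y z : V, y \in boundary L -> z \in boundary L ->
        odd (dist v y) = odd (dist v z)].

Definition closed_domain (L : {fset V}) : {fset V} := (L `|` boundary L)%fset.

Definition zero_boundary_homs (L : {fset V}) :
    set {ffun closed_domain L -> int} :=
  [set phi | (forall u w : closed_domain L,
                e (val u) (val w) -> `|phi u - phi w| = 1) /\
             (forall u : closed_domain L, val u \in boundary L -> phi u = 0)].

End Graph.

Arguments zero_boundary_homs {V} e L _.

(* Only used at vertices [v] of [D]. *)
Definition height {V : choiceType} (D : {fset V}) (phi : {ffun D -> int})
  (v : V) : int := oapp phi 0 (insub v).

Section Probability.
Variable R : realType.

(* The probability of [E] under the uniform law on the finite set [H]. *)
Definition uniform_prob {T : choiceType} (H E : set T) : R :=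
  (#|` fset_set (H `&` E)|)%:R / (#|` fset_set H|)%:R.

Context {V : choiceType}.
Variable e : rel V.

(* The probability that [X_1; ...; X_n] satisfies [E], for the simple random
   walk (X_k) on the graph started at X_0 = x. *)
Fixpoint srw_prob (n : nat) (x : V) (E : pred (seq V)) : R :=
  if n is m.+1 then
    (#|` nbrs e x|)%:R^-1 *
    \sum_(y <- nbrs e x) srw_prob m y (fun w => E (y :: w))
  else (E [::])%:R.

(* The probability that X_k = o for some k >= 1 when X_0 = o; the events
   "X_k = o for some 1 <= k <= n" increase to this one. *)
Definition return_prob (o : V) : R :=
  limn (fun n : nat => srw_prob n o (fun w => o \in w)).

Definition transient : Prop := forall o : V, return_prob o < 1.

(* The probability that phi_L(v) belongs to [B]. *)
Definition height_prob (L : {fset V}) (v : V) (B : set int) : R :=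
  uniform_prob (zero_boundary_homs e L)
    [set phi : {ffun closed_domain e L -> int} | B (height phi v)].

(* Tightness on the discrete space of integers, whose compact subsets are the
   finite ones. *)
Definition localized : Prop :=
  forall (v : V) (eps : R), 0 < eps ->
  exists K : set int, finite_set K /\
    forall L : {fset V}, admissible e v L -> height_prob L v (~` K) < eps.

Definition delocalized : Prop :=
  forall (v : V) (A : R), 0 < A -> forall eps : R, 0 < eps ->
  exists n : nat, forall L : {fset V}, admissible e v L ->
    (forall y : V, y \in boundary e L -> (n <= dist e v y)%N) ->
    height_prob L v [set z | `|z|%:~R <= A] < eps.

End Probability.

(* Main.v *)
Require Import Defs.
From mathcomp Require Import all_boot all_order all_algebra.
From mathcomp Require Import finmap.
From mathcomp Require Import all_classical all_reals all_analysis.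
From mathcomp Require Import ring lra zify.

(* Root the tree at [v] and eliminate the vertices of the domain one by one,
   leaves first. The weight of a vertex, an even function [f] of its height, is
   multiplied by [nbr_sum g : k |-> g (k - 1) + g (k + 1)] when a child of weight
   [g] is eliminated; interior vertices start from [1], boundary vertices from
   the Dirac mass at [0], and the final weight of [v] is its law. For Gaussian
   weights, multiplication adds inverse variances and [nbr_sum] adds [1] to the
   variance, as for conductances in parallel and in series with a unit resistor.
   Two inequalities replace the Gaussian computation.

   Localization: if [f (k + 2) <= exp (- c (k + 1)) f k], then [nbr_sum f] has
   the same property with [c / (1 + 2 c)], and products add the constants. So the
   constant at [v] is at least a third of a finite-domain conductance built from
   the escape probabilities of the walk, uniformly over the domains.

   Delocalization: call [f] starlike if [ln (f (k - 1) / f (k + 1)) / k] is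
   nondecreasing in [k > 0]. This is preserved by products, and by [nbr_sum]
   because the extremal case is that of a constant quotient. For starlike weights,
   summation by parts and Chebyshev's sum inequality show that
   [1 / (variance + 2)] is subadditive under products, while [nbr_sum] adds [1]
   to the variance. Hence [variance + 2] at [v] is at least an effective
   resistance, which tends to infinity in the recurrent case, and a starlike
   weight of large variance gives small mass to bounded sets. *)

Set Implicit Arguments.
Unset Strict Implicit.
Unset Printing Implicit Defensive.

Import Order.TTheory GRing.Theory Num.Theory.
Import numFieldNormedType.Exports.

Local Open Scope classical_set_scope.
Local Open Scope ring_scope.

(** * Starlike weights *)

Lemma eq_imp_le (R : numDomainType) (x y : R) : x = y -> x <= y.
Proof. by move=> ->. Qed.

(** * Roots of log-concave sequences *)

Section LogConcave.
Variables (R : realFieldType) (a : nat -> R).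
Hypothesis a_gt0 : forall m, 0 < a m.
Hypothesis a0 : a 0%N = 1.
Hypothesis a_lc : forall m, a m.+2 * a m <= a m.+1 ^+ 2.

Let a_ge0 m : 0 <= a m. Proof. exact: ltW. Qed.

(** Since [a 0 = 1], log-concavity makes the [m]-th root of [a m] nonincreasing in [m]; the
    statement clears the roots. The induction raises log-concavity at [m] to the power [m + 1]. *)
Lemma log_concave_succ m : a m.+1 ^+ m <= a m ^+ m.+1.
Proof.
elim: m => [|m IH]; first by rewrite expr0 a0 expr1n.
have h1 : (a m.+2 * a m) ^+ m.+1 <= (a m.+1 ^+ 2) ^+ m.+1.
  by rewrite ler_pXn2r // ?nnegrE ?mulr_ge0 ?exprn_ge0.
rewrite -(ler_pM2r (x := a m.+1 ^+ m)) ?exprn_gt0 //.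
apply: (@le_trans _ _ (a m.+2 ^+ m.+1 * a m ^+ m.+1)).
  by rewrite ler_pM2l ?exprn_gt0.
by rewrite -exprMn (le_trans h1) // -exprM -exprD (_ : (2 * m.+1 = m.+2 + m)%N) //; lia.
Qed.

Lemma log_concave_step2 m : a m.+2 ^+ m <= a m ^+ m.+2.
Proof.
rewrite -(@ler_pXn2r _ m.+1) ?nnegrE ?exprn_ge0 //.
rewrite -[leLHS]exprM mulnC exprM; apply: (@le_trans _ _ ((a m.+1 ^+ m.+2) ^+ m)).
  apply: lerXn2r; rewrite ?nnegrE ?exprn_ge0 //.
  exact: log_concave_succ.
rewrite -exprM mulnC exprM -[leRHS]exprM mulnC exprM.
by apply: lerXn2r; rewrite ?nnegrE ?exprn_ge0 ?log_concave_succ.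
Qed.

Lemma log_concave_power m : a m <= a 1%N ^+ m.
Proof.
case: m => [|m]; first by rewrite a0.
elim: m => [|m IH]; first by rewrite expr1.
rewrite -(@ler_pXn2r _ m.+1) ?nnegrE ?exprn_ge0 //.
apply: (le_trans (log_concave_succ _)); rewrite -exprM mulnC exprM.
by apply: lerXn2r; rewrite ?nnegrE ?exprn_ge0.
Qed.

End LogConcave.

(* With [t = exp (- c)], the neighbour sum of the Gaussian-like profile of
   slope [c] (that is, [f (k + 2) / f k = t ^ (k + 1)]) has the ratios
   [g (m + 1) / g (m - 1) = gauss_ratio t m]. *)
Definition gauss_ratio (R : realFieldType) (t : R) (m : nat) : R :=
  t ^+ m * (1 + t ^+ m.+1) / (t + t ^+ m).

Section GaussRatio.
Variables (R : realFieldType) (t : R).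
Hypothesis t01 : 0 < t <= 1.

Let t_gt0 : 0 < t. Proof. by case/andP: t01. Qed.

Lemma gauss_ratio_gt0 m : 0 < gauss_ratio t m.
Proof.
by rewrite divr_gt0 ?mulr_gt0 ?addr_gt0 ?exprn_gt0.
Qed.

Lemma gauss_ratio0 : gauss_ratio t 0 = 1.
Proof.
by rewrite /gauss_ratio expr0 expr1 mul1r addrC divff // gt_eqF // addr_gt0.
Qed.

Lemma gauss_ratio1 : gauss_ratio t 1 = (1 + t ^+ 2) / 2.
Proof.
rewrite /gauss_ratio expr1; have -> : t + t = t * 2 by ring.
by rewrite -mulf_div divff ?mul1r // gt_eqF.
Qed.

Lemma gauss_ratioS m :
  gauss_ratio t m.+1 = t ^+ m * (1 + t ^+ m.+2) / (1 + t ^+ m).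
Proof.
have wp : 0 < t ^+ m by rewrite exprn_gt0.
rewrite /gauss_ratio !exprS.
have -> : t + t * t ^+ m = t * (1 + t ^+ m) by ring.
by rewrite -(mulrA t) -mulf_div divff ?mul1r // gt_eqF.
Qed.

Lemma gauss_ratio_lc m :
  gauss_ratio t m.+2 * gauss_ratio t m <= gauss_ratio t m.+1 ^+ 2.
Proof.
have [w0 w1] : 0 < t ^+ m /\ t ^+ m <= 1.
  by split; rewrite ?exprn_gt0 ?exprn_ile1 ?(ltW t_gt0) //; case/andP: t01.
have t1 : t <= 1 by case/andP: t01.
rewrite !gauss_ratioS /gauss_ratio.
have -> : t ^+ m.+1 = t * t ^+ m by rewrite exprS.
have -> : t ^+ m.+2 = t ^+ 2 * t ^+ m by rewrite !exprS; ring.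
have -> : t ^+ m.+3 = t ^+ 3 * t ^+ m by rewrite !exprS; ring.
set w := t ^+ m in w0 w1 *.
have p1 : 0 < 1 + t * w by rewrite addr_gt0 ?mulr_gt0.
have p2 : 0 < t + w by rewrite addr_gt0.
have p3 : 0 < 1 + w by rewrite addr_gt0.
have -> : t * w * (1 + t ^+ 3 * w) / (1 + t * w) * (w * (1 + t * w) / (t + w))
   = w ^+ 2 * (t * (1 + t ^+ 3 * w)) / (t + w).
  by field; rewrite !gt_eqF.
have -> : (w * (1 + t ^+ 2 * w) / (1 + w)) ^+ 2
   = w ^+ 2 * (1 + t ^+ 2 * w) ^+ 2 / (1 + w) ^+ 2.
  by field; rewrite gt_eqF.
rewrite ler_pdivrMr // [leRHS]mulrAC ler_pdivlMr ?exprn_gt0 // -!mulrA ler_pM2l ?exprn_gt0 //.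
rewrite -subr_ge0.
(* Denominators and a common factor having been cleared, this product is the factored difference of
   the two sides. *)
have h : 0 <= w * w * (1 - t * w) * ((1 - t) ^+ 3 * (1 + t)).
  have tw : t * w <= 1 by rewrite mulr_ile1 ?(ltW t_gt0) ?(ltW w0).
  by rewrite !mulr_ge0 ?exprn_ge0 ?subr_ge0 ?addr_ge0 ?(ltW w0) ?(ltW t_gt0).
apply: (le_trans h); apply: eq_imp_le; ring.
Qed.

Lemma gauss_ratio_power m : gauss_ratio t m <= ((1 + t ^+ 2) / 2) ^+ m.
Proof.
rewrite -gauss_ratio1; apply: log_concave_power.
- exact: gauss_ratio_gt0.
- exact: gauss_ratio0.
- exact: gauss_ratio_lc.
Qed.

Lemma gauss_ratio_step2 m : gauss_ratio t m.+2 ^+ m <= gauss_ratio t m ^+ m.+2.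
Proof.
apply: log_concave_step2.
- exact: gauss_ratio_gt0.
- exact: gauss_ratio0.
- exact: gauss_ratio_lc.
Qed.

End GaussRatio.

(** The sum is over the two neighbours of [k] for the even extension of [f]; at [0] both have
    absolute value [1]. *)
Definition nbr_sum (R : realFieldType) (f : nat -> R) (k : nat) : R :=
  if k is m.+1 then f m + f m.+2 else f 1%N *+ 2.

(** * Stability of starlike weights under products and neighbour sums *)

Section Starlike.
Variable R : realType.
Implicit Types f g : nat -> R.

(** The division-free form, meaningful where [f] vanishes, of the statement that the [(k + 1)]-st
    root of [f (k + 2) / f k] does not increase when [k] becomes [k + 2]. *)
Definition starlike f : Prop :=
  forall k, f k.+4 ^+ k.+1 * f k ^+ k.+3 <= f k.+2 ^+ (2 * k + 4).

Definition decr2 f : Prop := (forall k, 0 <= f k) /\ forall k, f k.+2 <= f k.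

Lemma nbr_sum_ge0 f k : (forall k, 0 <= f k) -> 0 <= nbr_sum f k.
Proof. by move=> f0; case: k => [|k] /=; rewrite ?mulrn_wge0 ?addr_ge0. Qed.

Lemma decr2_nbr_sum f : decr2 f -> decr2 (nbr_sum f).
Proof.
move=> [f0 fd]; split=> [k|[|k]]; first exact: nbr_sum_ge0.
  by rewrite /= mulr2n lerD.
by rewrite /= lerD.
Qed.

Lemma decr2_mul f g : decr2 f -> decr2 g -> decr2 (fun k => f k * g k).
Proof. by move=> [f0 fd] [g0 gd]; split=> k; rewrite ?mulr_ge0 ?ler_pM. Qed.

Lemma starlike_mul f g : decr2 f -> decr2 g ->
  starlike f -> starlike g -> starlike (fun k => f k * g k).
Proof.
move=> [f0 _] [g0 _] sf sg k; rewrite !exprMn mulrACA.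
by apply: ler_pM (sf k) (sg k); rewrite mulr_ge0 ?exprn_ge0.
Qed.

Lemma exists_root (x : R) n : 0 <= x -> exists2 t, 0 <= t & t ^+ n.+1 = x.
Proof.
rewrite le_eqVlt => /predU1P[<-|x0]; first by exists 0 => //; rewrite expr0n.
exists (expR (ln x / n.+1%:R)); first exact: expR_ge0.
by rewrite -expRM_natl mulrCA divff ?pnatr_eq0 // mulr1 lnK.
Qed.

(** Take for [t] the [(k + 1)]-st root of [f (k + 2) / f k]. The Gaussian-like profile of parameter
    [t] that agrees with [f] at [k] and [k + 2] then dominates [f] at [k + 4] and at [k - 2]. *)
Lemma starlike_slope f k : decr2 f -> starlike f -> 0 < f k ->
  exists2 t, 0 <= t <= 1 & [/\ f k.+2 = t ^+ k.+1 * f k,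
    f k.+4 <= t ^+ k.+3 * f k.+2
  & (2 <= k)%N -> t ^+ k.-1 * f k.-2 <= f k].
Proof.
move=> [f0 fd] sf fk.
have [t t0 tE] := @exists_root (f k.+2 / f k) k (divr_ge0 (f0 _) (f0 _)).
have t1 : t <= 1.
  rewrite -(@expr_le1 _ k.+1) // tE ler_pdivrMr // mul1r //.
have fE : f k.+2 = t ^+ k.+1 * f k by rewrite tE divfK // gt_eqF.
exists t; [by rewrite t0|split=> //].
  have h0 : 0 <= t ^+ k.+3 * f k.+2 by exact: mulr_ge0 (exprn_ge0 _ t0) (f0 _).
  rewrite -(@ler_pXn2r _ k.+1) ?nnegrE //.
  rewrite -(@ler_pM2r _ (f k ^+ k.+3)) ?exprn_gt0 //.
  rewrite (le_trans (sf k)) // fE; apply: eq_imp_le.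
  rewrite mulrA -exprD (_ : (k.+3 + k.+1 = 2 * k + 4)%N); last by lia.
  rewrite (exprMn _ (t ^+ k.+1)) (exprMn _ (t ^+ (2 * k + 4))) -!exprM -mulrA.
  by rewrite -exprD; congr (_ ^+ _ * _ ^+ _); lia.
case: k fk t0 t1 tE fE => [|[|k]] //= fk t0 t1 tE fE _.
have h0 : 0 <= t ^+ k.+1 * f k by exact: mulr_ge0 (exprn_ge0 _ t0) (f0 _).
rewrite -(@ler_pXn2r _ k.+3) ?nnegrE //.
rewrite -(@ler_pM2r _ (f k.+2 ^+ k.+1)) ?exprn_gt0 // -exprD.
rewrite (_ : (k.+3 + k.+1 = 2 * k + 4)%N); last by lia.
rewrite (le_trans _ (sf k)) //; apply: eq_imp_le.
rewrite fE (exprMn _ (t ^+ k.+1)) (exprMn _ (t ^+ k.+3)) -!exprM.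
by rewrite mulrAC [(k.+3 * _)%N]mulnC.
Qed.

Lemma decr2_eq0 f k : decr2 f -> f k = 0 -> f k.+2 = 0.
Proof.
by move=> [f0 fd] fk; apply/le_anti/andP; split=> //; rewrite -[leRHS]fk.
Qed.

(** Replace [f] by the profile of [starlike_slope] at [k + 1]. The neighbour sum at [k + 2] is
    unchanged, those at [k] and [k + 4] can only grow, so the profile is the worst case; there the
    claim is [gauss_ratio_step2]. If [f (k + 1)] or [t] is zero, the neighbour sum vanishes at
    [k + 4]. *)
Lemma starlike_nbr_sum f : decr2 f -> starlike f -> starlike (nbr_sum f).
Proof.
move=> df sf k; have [f0 fd] := df; have [g0 gd] := decr2_nbr_sum df.
have gz : nbr_sum f k.+4 = 0 ->
    nbr_sum f k.+4 ^+ k.+1 * nbr_sum f k ^+ k.+3 <= nbr_sum f k.+2 ^+ (2 * k + 4).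
  by move=> ->; rewrite expr0n mul0r; apply/exprn_ge0/g0.
have /predU1P[y0|y0] : (f k.+1 == 0) || (0 < f k.+1).
  by rewrite eq_sym -le_eqVlt; exact: f0.
- have y3 := decr2_eq0 df y0; have y5 := decr2_eq0 df y3.
  by apply: gz; rewrite /= y3 y5 addr0.
have [t /andP[t0 t1] [E3 E5 Em]] := starlike_slope df sf y0.
move: t0; rewrite le_eqVlt => /predU1P[t0|t0].
  have y3 : f k.+3 = 0 by rewrite E3 -t0 exprS !mul0r.
  have y5 := decr2_eq0 df y3.
  by apply: gz; rewrite /= y3 y5 addr0.
have t01 : 0 < t <= 1 by rewrite t0.
have Em' : t ^+ k * nbr_sum f k <= f k.+1 * (1 + t ^+ k).
  case: (k) Em => [|j] /= Em; first by rewrite expr0 mul1r -mulr2n mulr_natr.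
  by rewrite !mulrDr mulr1 (mulrC (f _)) lerD2r Em.
set y := f k.+1 in y0 E3 Em' *.
have Gp m : 0 < gauss_ratio t m by exact: gauss_ratio_gt0.
set Y := y * (1 + t ^+ k.+2).
have Y0 : 0 < Y by rewrite mulr_gt0 ?addr_gt0 ?exprn_gt0.
have E2 : nbr_sum f k.+2 = Y by rewrite /= E3 /Y -/y; ring.
have E4 : nbr_sum f k.+4 <= Y * gauss_ratio t k.+3.
  rewrite gauss_ratioS // (_ : Y * _ = y * (t ^+ k.+2 * (1 + t ^+ k.+4))); last first.
    rewrite /Y; set b := 1 + t ^+ k.+2; rewrite -mulrA; congr (_ * _).
    by rewrite mulrC divfK // gt_eqF ?addr_gt0 ?exprn_gt0.
  rewrite [nbr_sum _ _]/= (le_trans (lerD (lexx _) E5)) // E3.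
  by apply: eq_imp_le; rewrite !exprS; ring.
have E0 : nbr_sum f k * gauss_ratio t k.+1 <= Y.
  rewrite gauss_ratioS // mulrA /Y ler_pdivrMr ?addr_gt0 ?exprn_gt0 //.
  rewrite mulrA [leRHS]mulrAC ler_pM2r ?addr_gt0 ?exprn_gt0 //.
  by rewrite mulrC.
rewrite E2 -(@ler_pM2r _ (gauss_ratio t k.+1 ^+ k.+3)) ?exprn_gt0 //.
rewrite -mulrA -exprMn.
apply: (@le_trans _ _ ((Y * gauss_ratio t k.+3) ^+ k.+1 * Y ^+ k.+3)).
  have nG i j : 0 <= nbr_sum f i * gauss_ratio t j by rewrite mulr_ge0 ?(ltW (Gp _)).
  have YG j : 0 <= Y * gauss_ratio t j by rewrite mulr_ge0 ?(ltW (Gp _)) ?(ltW Y0).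
  apply: ler_pM; [exact/exprn_ge0/g0 | exact/exprn_ge0/nG | |].
    by apply: lerXn2r; rewrite ?nnegrE; [exact: g0 | exact: YG | exact: E4].
  by apply: lerXn2r; rewrite ?nnegrE; [exact: nG | exact: ltW | exact: E0].
rewrite exprMn mulrAC -exprD (_ : (k.+1 + k.+3 = 2 * k + 4)%N); last by lia.
by rewrite ler_pM2l ?exprn_gt0 // gauss_ratio_step2.
Qed.

End Starlike.

(** * Chebyshev's sum inequality *)

Section Chebyshev.
Variable R : realFieldType.
Implicit Types a b q : nat -> R.

(** Twice the left side minus twice the right side is the double sum of
    [(a i * b j - a j * b i) * (q i - q j)], whose terms are symmetric in [i] and [j]. *)
Lemma chebyshev_sum N a b q :
  (forall i j, (i <= j < N)%N -> (a i * b j - a j * b i) * (q i - q j) <= 0) ->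
  (\sum_(i < N) a i * q i) * (\sum_(i < N) b i) <=
  (\sum_(i < N) a i) * (\sum_(i < N) b i * q i).
Proof.
move=> abq; rewrite -subr_le0 !big_distrlr /= -sumrB.
under eq_bigr do rewrite -sumrB.
set S := (X in X <= 0).
suff : S + S <= 0 by lra.
rewrite {2}/S exchange_big /= /S -big_split /= sumr_le0 // => i _.
rewrite -big_split /= sumr_le0 // => j _.
have [ij|/ltnW ji] := leqP i j.
  by have := abq i j; rewrite ij ltn_ord => /(_ isT); lra.
by have := abq j i; rewrite ji ltn_ord => /(_ isT); lra.
Qed.

End Chebyshev.

(** * Convexity bounds for powers *)

Section ChordBounds.
Variables (R : realFieldType) (t : R).
Hypothesis t01 : 0 <= t <= 1.

Let t0 : 0 <= t. Proof. by case/andP: t01. Qed.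
Let t1 : t <= 1. Proof. by case/andP: t01. Qed.
Let tX0 n : 0 <= t ^+ n. Proof. exact: exprn_ge0. Qed.

(** The quotient of [1 - t ^ n] by [1 - t] is a sum of [n] powers of [t], each at most [1] and, for
    [geo_lb], at least [t ^ n]. *)
Lemma geo_ub n : 1 - t ^+ n <= n%:R * (1 - t).
Proof.
elim: n => [|n IH]; first by rewrite expr0 subrr mul0r.
rewrite exprS -natr1.
have : 0 <= (1 - t) * (1 - t ^+ n) by rewrite mulr_ge0 ?subr_ge0 ?exprn_ile1.
lra.
Qed.

Lemma geo_lb n : n%:R * t ^+ n * (1 - t) <= 1 - t ^+ n.
Proof.
elim: n => [|n IH]; first by rewrite expr0 subrr !mul0r.
rewrite exprS -natr1; have := tX0 n; have := exprn_ile1 n t0 t1.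
move=> w1 w0; set w := t ^+ n in IH w0 w1 *; set m : R := n%:R in IH *.
have m0 : 0 <= m by [].
have t2 : 0 <= 1 - t by rewrite subr_ge0.
have := mulr_ge0 (mulr_ge0 m0 w0) (mulr_ge0 t2 t2).
have := mulr_ge0 (mulr_ge0 w0 t2) t2; have := mulr_ge0 w0 t2.
have := mulr_ge0 t0 (_ : 0 <= 1 - w - m * w * (1 - t)); rewrite subr_ge0 IH => /(_ isT).
lra.
Qed.

(** Convexity of [i |-> t ^ i] at the points [0], [a] and [a + b]. *)
Lemma chord_le a b : (a + b)%:R * t ^+ a <= b%:R + a%:R * t ^+ (a + b).
Proof.
have h1 : a%:R * t ^+ a * (1 - t ^+ b) <= a%:R * t ^+ a * (b%:R * (1 - t)).
  by rewrite ler_wpM2l ?mulr_ge0 // geo_ub.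
have h2 : b%:R * (a%:R * t ^+ a * (1 - t)) <= b%:R * (1 - t ^+ a).
  by rewrite ler_wpM2l // geo_lb.
by rewrite natrD exprD; lra.
Qed.

(** Each power is bounded by the chord of [i |-> t ^ i] through [i = 1] and [i = L + 1]; the right
    side is [2 * L] times the sum of the chord over [a <= i < a + n]. *)
Lemma chord_sum L a n : (0 < a)%N -> (a + n <= L.+2)%N ->
  2 * L%:R * (\sum_(i < n) t ^+ (a + i)) <= 2 * n%:R * L%:R * t ^+ L.+1
    + (t - t ^+ L.+1) * n%:R * (2 * (L%:R + 1 - a%:R) - (n%:R - 1)).
Proof.
move=> a0; elim: n => [|n IH] anL; first by rewrite big_ord0 mulr0 !mulr0 !mul0r addr0.
rewrite big_ord_recr /= mulrDr.
have {}IH := IH (leq_trans (leq_add (leqnn a) (leqnSn n)) anL).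
have := chord_le (a + n).-1 (L.+1 - (a + n)).
have -> : ((a + n).-1 + (L.+1 - (a + n)) = L)%N by lia.
have -> : (L.+1 - (a + n))%:R = L%:R + 1 - a%:R - n%:R :> R.
  by rewrite natrB ?natrD -?natr1 ?opprD ?addrA //; lia.
have -> : (a + n).-1%:R = a%:R + n%:R - 1 :> R.
  by rewrite -natrD -[in RHS](prednK (n := a + n)) -?natr1 ?addrK //; lia.
have e1 : t ^+ (a + n) = t * t ^+ (a + n).-1 by rewrite -exprS prednK //; lia.
move=> h; have {h} := ler_wpM2l t0 h.
by rewrite e1 [t ^+ L.+1]exprS -[n.+1%:R]natr1 in IH *; lra.
Qed.

(* Dividing by [1 - t], the difference of the two sides has coefficients of
   signs [+, -, +]; the middle powers lie below the chord of [i |-> t ^ i]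
   through [i = 1] and [i = 2 j + 2], the outer ones above it. *)
Lemma slope_poly_le j (x : R) : (2 <= j)%N -> x = j%:R ->
  t ^+ 2 * ((x - 1) + 2 * t ^+ j.-1 - (x + 1) * t ^+ (j.-1 + j.+1))
    * ((x + 2) ^+ 2 + 2)
  <= (x ^+ 2 + 2) * ((x + 1) + 2 * t ^+ j.+1 - (x + 3) * t ^+ (j.+1 + j.+3)).
Proof.
move=> j2 xj.
pose P n : R := \sum_(i < n) t ^+ i.
have PE n : 1 - t ^+ n = (1 - t) * P n by rewrite -opprB subrX1 -mulNr opprB.
have PX m n : t ^+ m * P n = \sum_(i < n) t ^+ (m + i).
  by rewrite /P mulr_sumr; apply: eq_bigr => i _; rewrite exprD.
pose A := t ^+ 2 * P j.-1; pose B := t ^+ j.+1 * P j.+1.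
pose Y := t ^+ (2 * j).+2.
have xE : j.-1%:R = x - 1 :> R.
  by rewrite xj -{2}(prednK (n := j)) -?natr1 ?addrK //; lia.
have x2 : 2 <= x by rewrite xj ler_nat.
have P1 : P j.+1 = 1 + t + A.
  rewrite /A /P; case: (j) j2 => [|[|i]] //= _.
  rewrite big_ord_recl big_ord_recl /= expr0 /bump /= expr1 -addrA; congr (_ + (_ + _)).
  by rewrite mulr_sumr; apply: eq_bigr => k _; rewrite -exprD.
have P3 : t ^+ j.+1 * P j.+3 = B + Y + Y * t.
  have PS n : P n.+1 = P n + t ^+ n by rewrite /P big_ord_recr.
  rewrite (PS j.+2) (PS j.+1) /B 2!mulrDr; congr (_ + _ + _); rewrite -exprD /Y -?exprSr.
    by congr (_ ^+ _); lia.
  by congr (_ ^+ _); lia.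
have key : ((x + 2) ^+ 2 + 2) * ((x - 1) * A + (x + 1) * B) <=
    (x ^+ 2 + 2) * ((x + 1) * P j.+1 + (x + 3) * (t ^+ j.+1 * P j.+3)).
  rewrite P1 P3; set L : R := 2 * x + 1.
  have LE : (2 * j).+1%:R = L by rewrite -natr1 natrM -xj.
  have hA : 2 * L * A <= 2 * (x - 1) * L * Y
      + (t - Y) * (x - 1) * (2 * (L + 1 - 2) - (x - 1 - 1)).
    have := @chord_sum (2 * j).+1 2 j.-1 isT; rewrite LE xE.
    rewrite /A PX.
    by apply; lia.
  have hB : 2 * L * B <= 2 * (x + 1) * L * Y
      + (t - Y) * (x + 1) * (2 * (L + 1 - (x + 1)) - (x + 1 - 1)).
    have := @chord_sum (2 * j).+1 j.+1 j.+1 isT; rewrite LE -[j.+1%:R]natr1 -xj.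
    rewrite /B PX.
    by apply; lia.
  have YE : Y = t * t ^+ (2 * j).+1 by rewrite /Y exprS.
  have h0 : t - Y <= L * (1 - t).
    have := geo_ub (2 * j).+1; rewrite LE YE; have := tX0 (2 * j).+1.
    have := exprn_ile1 (2 * j).+1 t0 t1; nra.
  have h1 : L * (Y * (1 - t)) <= t - Y.
    have := ler_wpM2l t0 (geo_lb (2 * j).+1); rewrite LE YE; lra.
  have Y0 : 0 <= Y by exact: tX0.
  have D0 : 0 <= t - Y.
    by rewrite YE -[X in X - _]mulr1 -mulrBr mulr_ge0 ?subr_ge0 ?exprn_ile1.
  have L0 : 0 < L by rewrite /L; lra.
  have xx : 0 <= (x - 2) ^+ 2 by exact: sqr_ge0.
  (* The first two multipliers come from the coefficients of [A] and [B] in [key], once the two sums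
     on its right side are expanded. The other two bounds compare the remaining terms [1 + t] and
     [Y * (1 + t)] with the ends of the chord. *)
  have := ler_wpM2l (_ : 0 <= 2 * x ^+ 2 - 8) hA.
  have := ler_wpM2l (_ : 0 <= 2 * x ^+ 2 + 8 * x) hB.
  have := ler_wpM2l (_ : 0 <= 2 * ((x + 1) * (x ^+ 2 + 2))) h0.
  have := ler_wpM2l (_ : 0 <= 2 * ((x + 3) * (x ^+ 2 + 2))) h1.
  have g1 : 0 <= L * (8 * x + 8) * Y by apply: mulr_ge0 Y0; apply: mulr_ge0 (ltW L0) _; lra.
  have g2 : 0 <= (8 * x ^+ 2 - 8) * (t - Y) by apply: mulr_ge0 D0; lra.
  have e1 : 0 <= 2 * x ^+ 2 - 8 by lra.
  have e2 : 0 <= 2 * x ^+ 2 + 8 * x by lra.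
  have e3 : 0 <= 2 * ((x + 1) * (x ^+ 2 + 2)).
    by apply: mulr_ge0 => //; apply: mulr_ge0; lra.
  have e4 : 0 <= 2 * ((x + 3) * (x ^+ 2 + 2)).
    by apply: mulr_ge0 => //; apply: mulr_ge0; lra.
  move=> /(_ e4) k4 /(_ e3) k3 /(_ e2) k2 /(_ e1) k1.
  rewrite -(ler_pM2l (mulr_gt0 (ltr0n R 2) L0)).
  move: k1 k2 k3 k4 g1 g2; rewrite /L; lra.
have a1 : (x - 1) + 2 * t ^+ j.-1 - (x + 1) * t ^+ (j.-1 + j.+1) =
   (1 - t) * ((x - 1) * P j.-1 + (x + 1) * (t ^+ j.-1 * P j.+1)).
  rewrite mulrDr !(mulrCA (1 - t)) -!PE exprD; ring.
have a2 : (x + 1) + 2 * t ^+ j.+1 - (x + 3) * t ^+ (j.+1 + j.+3) =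
   (1 - t) * ((x + 1) * P j.+1 + (x + 3) * (t ^+ j.+1 * P j.+3)).
  rewrite mulrDr !(mulrCA (1 - t)) -!PE exprD; ring.
rewrite a1 a2; have := ler_wpM2l (_ : 0 <= 1 - t) key; rewrite subr_ge0 => /(_ t1).
have -> : B = t ^+ 2 * (t ^+ j.-1 * P j.+1).
  by rewrite /B mulrA -exprD; congr (t ^+ _ * _); lia.
rewrite /A; lra.
Qed.

End ChordBounds.

(** * Variance of starlike weights *)

(* An even function on the integers is encoded by its restriction to [nat];
   [two_sided j] is the number of integers of absolute value [j]. *)
Definition two_sided (R : realFieldType) (j : nat) : R := if j is 0%N then 1 else 2.

Definition quad (R : realFieldType) (j : nat) : R := j%:R ^+ 2 + 2.

(* [drift f j] is [k (f (k - 1) - f (k + 1))] summed over the two neighbours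
   [k] of [j]; at [j = 0] the truncated [j - 2] stands for [-2]. *)
Definition drift (R : realFieldType) (f : nat -> R) (j : nat) : R :=
  (j%:R - 1) * f (j - 2)%N + 2 * f j - (j%:R + 1) * f j.+2.

Definition parity_supported (R : realFieldType) (b : bool) (f : nat -> R) : Prop :=
  forall j, odd j != b -> f j = 0.

Section Sums.
Variable R : realFieldType.
Implicit Types f g : nat -> R.

Lemma two_sided_gt0 j : 0 < two_sided R j.
Proof. by case: j. Qed.

Lemma quad_gt0 j : 0 < quad R j.
Proof. by rewrite ltr_wpDl ?sqr_ge0. Qed.

Lemma sum_widen f N M : (N <= M)%N -> (forall j, (N <= j)%N -> f j = 0) ->
  \sum_(j < M) f j = \sum_(j < N) f j.
Proof.
move=> NM f0; rewrite (big_ord_widen _ f NM) [RHS]big_mkcond /=.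
by apply: eq_bigr => j _; case: ltnP => // /f0.
Qed.

(** Summation by parts: the cross term [f (j + 2) * g j] has coefficient [- (j + 1)] at index [j]
    and [j + 1] at index [j + 2]. Only diagonal terms and boundary terms survive, and the latter
    vanish once [m] is beyond the supports. *)
Lemma sum_drift f g m :
  \sum_(j < m.+1) (drift f j * g j + drift g j * f j) =
  2 * (\sum_(j < m.+1) two_sided R j * (f j * g j))
  - (m%:R + 1) * (f m * g m.+2 + f m.+2 * g m)
  - m%:R * (f m.-1 * g m.+1 + f m.+1 * g m.-1).
Proof.
elim: m => [|m IH]; first by rewrite !big_ord1 /drift /=; ring.
rewrite big_ord_recr IH [in RHS]big_ord_recr /= /drift subSS.
rewrite -subn1; case: m {IH} => [|m]; rewrite /= ?subn1 /= -?[_.+1%:R]natr1; ring.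
Qed.

Lemma sum_nbr_sum f m :
  \sum_(j < m.+1) two_sided R j * nbr_sum f j =
  2 * (\sum_(j < m.+1) two_sided R j * f j) - 2 * f m + 2 * f m.+1.
Proof.
elim: m => [|m IH]; first by rewrite !big_ord1 /=; ring.
by rewrite big_ord_recr IH [in RHS]big_ord_recr /=; ring.
Qed.

(** The mean of [(j - 1) ^ 2] and [(j + 1) ^ 2] is [j ^ 2 + 1]; with [sum_nbr_sum], where the mass
    doubles, this says that the variance grows by [1], up to boundary terms. *)
Lemma sum_quad_nbr_sum f m :
  \sum_(j < m.+1) two_sided R j * quad R j * nbr_sum f j =
  2 * (\sum_(j < m.+1) two_sided R j * quad R j * f j)
  + 2 * (\sum_(j < m.+1) two_sided R j * f j)
  - 2 * quad R m.+1 * f m + 2 * quad R m * f m.+1.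
Proof.
elim: m => [|m IH]; first by rewrite !big_ord1 /quad /=; ring.
rewrite big_ord_recr IH !(big_ord_recr m.+1) /= /quad -!natr1; ring.
Qed.

End Sums.

(** * Monotonicity of the quotient of drift and moment *)

Section Drift.
Variable R : realType.
Implicit Types f g : nat -> R.

Lemma drift_ge0 f j : decr2 f -> 0 <= drift f j.
Proof.
move=> [f0 fd]; rewrite /drift; case: j => [|[|j]] /=.
- have := fd 0%N; lra.
- have := fd 1%N; lra.
rewrite subSS subSS subn0 -!natr1.
have h1 := ler_wpM2l (ler0n R j.+1) (fd j).
have := ler_wpM2l (ler0n R j.+3) (fd j.+2).
move: h1; rewrite -!natr1; lra.
Qed.

(** Bounding [f (j - 2)] and [f (j + 4)] by the profile of [starlike_slope] raises the drift at [j]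
    and lowers it at [j + 2]. What remains is a polynomial inequality in [t]: [slope_poly_le] for
    [j >= 2], a direct factorization for [j = 0] and [j = 1]. *)
Lemma drift_step f j : decr2 f -> starlike f ->
  drift f j * (two_sided R j.+2 * quad R j.+2 * f j.+2) <=
  drift f j.+2 * (two_sided R j * quad R j * f j).
Proof.
move=> df sf; have [f0 fd] := df.
have /predU1P[y0|y0] : (f j == 0) || (0 < f j).
  by rewrite eq_sym -le_eqVlt; exact: f0.
  by rewrite (decr2_eq0 df y0) y0 !mulr0.
have [t t01 [E2 E4 Em]] := starlike_slope df sf y0.
have /andP[t0 t1] := t01.
case: j y0 E2 E4 Em => [|[|j]] y0 E2 E4 Em.
- rewrite /drift /quad /= subn2 /= !expr1 in E2 E4 *.
  set F := f 0%N in y0 E2 *.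
  have E4' : f 4%N <= t ^+ 4 * F by rewrite (le_trans E4) // E2 mulrA -exprSr.
  have h1 := ler_wpM2l (ltW y0) E4'.
  have p : 0 <= (F * F) * ((1 - t) * ((1 - t) ^+ 3 + 4 * t ^+ 3)).
    have F0 := ltW y0; have t2 : 0 <= 1 - t by rewrite subr_ge0.
    apply: mulr_ge0; first exact: mulr_ge0.
    by apply: mulr_ge0 => //; rewrite addr_ge0 ?mulr_ge0 ?exprn_ge0.
  rewrite E2; lra.
- rewrite /drift /quad /= in E2 E4 *.
  set F := f 1%N in y0 E2 *.
  have E4' : f 5%N <= t ^+ 4 * (t ^+ 2 * F) by rewrite (le_trans E4) // E2.
  have h1 := ler_wpM2l (ltW y0) E4'.
  set q := t ^+ 2 in E2 E4' h1.
  have q01 : 0 <= 1 - q by rewrite subr_ge0 exprn_ile1.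
  have p : 0 <= (F * F) * ((1 - q) * ((q * 6 - 5 / 2) ^+ 2 + 47 / 4)).
    have F0 := ltW y0; apply: mulr_ge0; first exact: mulr_ge0.
    by apply: mulr_ge0 => //; rewrite addr_ge0 ?sqr_ge0.
  have tq : t ^+ 4 = q * q by rewrite /q -exprD.
  rewrite E2; rewrite tq in h1; lra.
have /= {}Em := Em isT.
pose x : R := j.+2%:R.
have poly := @slope_poly_le R t t01 j.+2 x isT erefl.
set F := f j.+2 in y0 E2 E4 Em *.
have dE : drift f j.+2 = (x - 1) * f j + 2 * F - (x + 1) * f j.+4 by rewrite /drift subSS subSS subn0.
have dE2 : drift f j.+4 = (x + 1) * F + 2 * f j.+4 - (x + 3) * f j.+4.+2.
  rewrite /drift subSS subSS subn0 /x -![j.+4%:R]natr1 -![j.+3%:R]natr1 -/F; ring.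
have x2 : 2 <= x by rewrite /x ler_nat.
have qE : quad R j.+2 = x ^+ 2 + 2 by [].
have qE2 : quad R j.+4 = (x + 2) ^+ 2 + 2.
  by rewrite /quad; congr (_ ^+ 2 + _); rewrite -![j.+4%:R]natr1 -![j.+3%:R]natr1 /x; ring.
rewrite qE qE2 /two_sided.
have h1 : t ^+ j.+1 * drift f j.+2 <=
    F * ((x - 1) + 2 * t ^+ j.+1 - (x + 1) * t ^+ (j.+1 + j.+3)).
  have := ler_wpM2l (_ : 0 <= x - 1) Em; rewrite dE E2 exprD => /(_ _); lra.
have h2 : F * ((x + 1) + 2 * t ^+ j.+3 - (x + 3) * t ^+ (j.+3 + j.+4.+1))
    <= drift f j.+4.
  have := ler_wpM2l (_ : 0 <= x + 3) E4; rewrite dE2 E2 exprD => /(_ _); lra.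
have k1 := ler_wpM2l (_ : 0 <= 2 * F * (t ^+ 2 * ((x + 2) ^+ 2 + 2))) h1.
have k2 := ler_wpM2l (_ : 0 <= 2 * F * (x ^+ 2 + 2)) h2.
have k3 := ler_wpM2l (_ : 0 <= 2 * (F * F)) poly.
have F0 := ltW y0; have t20 := sqr_ge0 t.
have s1 : 0 <= (x + 2) ^+ 2 + 2 by rewrite addr_ge0 ?sqr_ge0.
have s2 : 0 <= x ^+ 2 + 2 by rewrite addr_ge0 ?sqr_ge0.
have {}k1 := k1 (mulr_ge0 (mulr_ge0 (ler0n _ 2) F0) (mulr_ge0 t20 s1)).
have {}k2 := k2 (mulr_ge0 (mulr_ge0 (ler0n _ 2) F0) s2).
have {}k3 := k3 (mulr_ge0 (ler0n _ 2) (mulr_ge0 F0 F0)).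
have tt : t ^+ j.+3 = t ^+ 2 * t ^+ j.+1 by rewrite -exprD.
rewrite E2 tt; move: k1 k2 k3; rewrite /=; lra.
Qed.

Definition moment f j : R := two_sided R j * quad R j * f j.

Lemma moment_ge0 f j : decr2 f -> 0 <= moment f j.
Proof.
by move=> [f0 _]; rewrite !mulr_ge0 ?(ltW (two_sided_gt0 _ _)) ?(ltW (quad_gt0 _ _)).
Qed.

Lemma drift_mono f i n : decr2 f -> starlike f ->
  drift f i * moment f (i + n.*2) <= drift f (i + n.*2) * moment f i.
Proof.
move=> df sf; elim: n => [|n IH]; first by rewrite addn0.
rewrite doubleS !addnS; set j := (i + n.*2)%N in IH *.
have st := drift_step j df sf.
have bi := moment_ge0 i df; have bj := moment_ge0 j df; have bj2 := moment_ge0 j.+2 df.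
have [fj|fj] := eqVneq (f j) 0.
  rewrite {1}/moment (decr2_eq0 df fj) !mulr0.
  by rewrite mulr_ge0 ?drift_ge0.
have bj0 : 0 < moment f j.
  rewrite !mulr_gt0 ?two_sided_gt0 ?quad_gt0 // lt_neqAle eq_sym fj.
  by have [->] := df.
rewrite -(ler_pM2r bj0).
apply: (@le_trans _ _ (drift f j * moment f i * moment f j.+2)).
  by rewrite mulrAC ler_wpM2r.
by rewrite mulrAC [leRHS]mulrAC ler_wpM2r.
Qed.

(** Along one parity class the quotient of [drift f] by [moment f] is nondecreasing and [q]
    nonincreasing; on the other class both [drift f] and [moment f] vanish. *)
Lemma sum_drift_chebyshev b f q N : decr2 f -> starlike f -> parity_supported b f ->
  (forall j, q j.+2 <= q j) ->
  (\sum_(j < N) drift f j * q j) * (\sum_(j < N) moment f j) <=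
  (\sum_(j < N) drift f j) * (\sum_(j < N) moment f j * q j).
Proof.
move=> df sf pf qd; apply: chebyshev_sum => i j /andP[ij _].
have z k : odd k != b -> drift f k = 0 /\ moment f k = 0.
  move=> kb; split; last by rewrite /moment pf // mulr0.
  rewrite /drift (pf k) // (pf k.+2) /= ?negbK // !mulr0.
  (* At [k = 1] the truncated [k - 2] falls in the other parity class, but its coefficient [k - 1]
     vanishes. *)
  case: k kb => [|[|k]] kb; first by rewrite pf // !mulr0 addr0 subr0.
    by rewrite subrr mul0r addr0 subr0.
  by rewrite subSS subSS subn0 pf ?mulr0 ?addr0 ?subr0 //; rewrite /= negbK in kb.
have [ib|/z[-> ->]] := eqVneq (odd i) b; last by rewrite mul0r mulr0 subrr mul0r.
have [jb|/z[-> ->]] := eqVneq (odd j) b; last by rewrite mul0r mulr0 subrr mul0r.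
have [n jE] : exists n, j = (i + n.*2)%N.
  exists (j - i)./2; rewrite even_halfK ?subnKC // oddB // ib jb addbb //.
rewrite jE; have h1 := drift_mono i n df sf.
apply: mulr_le0_ge0; first by rewrite subr_le0.
rewrite subr_ge0; elim: (n) => [|m IH]; first by rewrite addn0.
by rewrite doubleS !addnS; exact: le_trans (qd _) IH.
Qed.

End Drift.

(** * Inverse variance under products and neighbour sums *)

Section Spread.
Variable R : realType.
Implicit Types f g : nat -> R.

(* [s] bounds the inverse of (variance + 2); it behaves as an effective
   conductance under products and neighbour sums. *)
Definition confined (s : R) f : Prop := exists N b,
  [/\ forall j, (N <= j)%N -> f j = 0, parity_supported b f &
      \sum_(j < N) two_sided R j * f j <= s * \sum_(j < N) moment f j].

(** A constant weight, such as the initial one of an interior vertex, has no finite mass; it counts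
    as having infinite variance and is accepted with every [s >= 0]. *)
Definition spread f (s : R) : Prop :=
  [/\ 0 <= s, decr2 f, starlike f & (forall k, f k = f 0%N) \/ confined s f].

Lemma sum_drift1 f m : \sum_(j < m.+1) drift f j =
  2 * (\sum_(j < m.+1) two_sided R j * f j)
  - (m%:R + 1) * (f m + f m.+2) - m%:R * (f m.-1 + f m.+1).
Proof.
have d1 j : drift (fun=> 1 : R) j = 0 by rewrite /drift; ring.
have := sum_drift f (fun=> 1) m; rewrite !mulr1.
under eq_bigr do rewrite d1 mul0r addr0 mulr1.
by under [in RHS]eq_bigr do rewrite mulr1.
Qed.

Lemma confined_widen s f M : (exists N b,
    [/\ (N <= M)%N, forall j, (N <= j)%N -> f j = 0, parity_supported b f &
      \sum_(j < N) two_sided R j * f j <= s * \sum_(j < N) moment f j]) ->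
  \sum_(j < M) two_sided R j * f j <= s * \sum_(j < M) moment f j.
Proof.
move=> [N [b [NM f0 _ fs]]].
rewrite (@sum_widen _ (fun j => two_sided R j * f j) N) //; last first.
  by move=> j /f0 ->; rewrite mulr0.
by rewrite (@sum_widen _ (moment f) N) // => j /f0 E; rewrite /moment E mulr0.
Qed.

Lemma sum_moment_ge0 f N : decr2 f -> 0 <= \sum_(j < N) moment f j.
Proof. by move=> df; apply: sumr_ge0 => j _; exact: moment_ge0. Qed.

Lemma spread_weaken f s t : spread f s -> s <= t -> spread f t.
Proof.
move=> [s0 df sf h] st; split=> //; first exact: le_trans st.
case: h => [h|[N [b [f0 pf fs]]]]; [by left|right; exists N, b; split=> //].
by rewrite (le_trans fs) // ler_wpM2r ?sum_moment_ge0.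
Qed.

Lemma spread_const c : 0 <= c -> spread (fun=> c) 0.
Proof.
move=> c0; split=> //; [move=> k|by left].
by rewrite -exprD (_ : (k.+1 + k.+3 = 2 * k + 4)%N) ?lexx //; lia.
Qed.

Lemma spread_delta : spread (fun j => (j == 0%N)%:R) 1.
Proof.
split=> //; first by move=> k; rewrite expr0n /= mul0r exprn_ge0.
right; exists 1%N, false; split=> [[]//|[]//|].
by rewrite !big_ord1 /moment /quad /=; lra.
Qed.

Lemma spread_scale c f s : 0 <= c -> spread f s -> spread (fun k => c * f k) s.
Proof.
move=> c0 [s0 df sf h]; split=> //.
- by apply: decr2_mul df; case: (spread_const c0).
- by have [_ dc sc _] := spread_const c0; exact: starlike_mul.
case: h => [h|[N [b [f0 pf fs]]]]; first by left => k; rewrite h.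
right; exists N, b; split=> [j /f0 ->|j /pf ->|]; rewrite ?mulr0 //.
under eq_bigr do rewrite mulrCA.
rewrite -mulr_sumr; under [in leRHS]eq_bigr do rewrite /moment mulrCA.
by rewrite -mulr_sumr mulrCA ler_wpM2l.
Qed.

Lemma spread_eq f g s : f =1 g -> spread f s -> spread g s.
Proof. by move=> /funext ->. Qed.

(** Beyond the supports, [sum_drift] writes twice the mass of [f * g] as the sum of
    [drift f * g + drift g * f]. Chebyshev's inequality bounds the sum of [drift f * g] by the
    moment of [f * g] times the quotient of the total drift of [f], which is twice its mass, by its
    total moment; that quotient is at most [2 * s]. The other half gives [2 * t]. *)
Lemma confined_mul f g s t : 0 <= s -> 0 <= t -> decr2 f -> decr2 g ->
  starlike f -> starlike g -> confined s f -> confined t g ->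
  confined (s + t) (fun k => f k * g k).
Proof.
move=> s0 t0 df dg sf sg [N1 [b1 [f0 pf fs]]] [N2 [b2 [g0 pg gs]]].
pose M := (N1 + N2).+1; exists M, b1.
have Mge j : (M <= j)%N -> (N1 + N2 <= j)%N := leq_trans (leqnSn _).
have fM := @confined_widen s f M (ex_intro _ N1 (ex_intro _ b1 (And4 _ f0 pf fs))).
have gM := @confined_widen t g M (ex_intro _ N2 (ex_intro _ b2 (And4 _ g0 pg gs))).
have {}fM := fM (leqW (leq_addr _ _)).
have {}gM := gM (leqW (leq_addl _ _)).
have dfg := decr2_mul df dg.
split=> [j jM|j /pf ->|]; rewrite ?mul0r //.
  by rewrite f0 ?mul0r // (leq_trans _ jM) // leqW ?leq_addr.
(* Supports of opposite parities make the product zero. *)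
have [b12|b12] := eqVneq b1 b2; last first.
  rewrite big1 ?mulr_ge0 ?addr_ge0 ?sum_moment_ge0 // => j _.
  have [jb|/pf ->] := eqVneq (odd j) b1; last by rewrite mul0r mulr0.
  by rewrite pg ?mulr0 // jb.
have zf j : (N1 + N2 <= j)%N -> f j = 0.
  by move=> h; rewrite f0 // (leq_trans _ h) // leq_addr.
have zg j : (N1 + N2 <= j)%N -> g j = 0.
  by move=> h; rewrite g0 // (leq_trans _ h) // leq_addl.
have dr h : (forall j, (N1 + N2 <= j)%N -> h j = 0) ->
    \sum_(j < M.+1) drift h j = 2 * \sum_(j < M.+1) two_sided R j * h j.
  by move=> h0; rewrite sum_drift1 !h0 ?addr0 ?mulr0 ?subr0 //;
    rewrite /M /= ?leqW.
have pq : \sum_(j < M.+1) drift f j * g j + \sum_(j < M.+1) drift g j * f j =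
    2 * \sum_(j < M.+1) two_sided R j * (f j * g j).
  rewrite -big_split /= sum_drift !(zf M, zg M, zf M.+2, zg M.+2, zf M.+1, zg M.+1) //;
    try by rewrite /M ?leqW.
  by rewrite !(mul0r, mulr0, addr0, subr0).
set S := \sum_(j < M) two_sided R j * (f j * g j).
set T := \sum_(j < M) moment (fun k => f k * g k) j.
have SE : \sum_(j < M.+1) two_sided R j * (f j * g j) = S.
  apply: (@sum_widen _ (fun j => two_sided R j * (f j * g j)) M) => // j Mj.
  by rewrite zf ?mul0r ?mulr0 // Mge.
have TE : \sum_(j < M.+1) moment (fun k => f k * g k) j = T.
  apply: (@sum_widen _ (moment (fun j => f j * g j)) M) => // j Mj.
  by rewrite /moment zf ?mul0r ?mulr0 // Mge.
have T0 : 0 <= T by exact: sum_moment_ge0.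
have half h k r c : 0 <= r -> decr2 h -> decr2 k -> starlike h -> parity_supported c h ->
    (forall j, (N1 + N2 <= j)%N -> h j = 0) ->
    \sum_(j < M.+1) two_sided R j * h j <= r * \sum_(j < M.+1) moment h j ->
    \sum_(j < M.+1) drift h j * k j <=
      2 * r * \sum_(j < M.+1) moment (fun j => h j * k j) j.
  move=> r0 dh dk sh ph zh hr; have [h0 _] := dh; have [k0 kd] := dk.
  have cs := sum_drift_chebyshev M.+1 dh sh ph kd.
  have me : \sum_(j < M.+1) moment h j * k j = \sum_(j < M.+1) moment (fun j => h j * k j) j.
    by apply: eq_bigr => j _; rewrite /moment mulrA.
  rewrite me dr // in cs.
  have m0 := sum_moment_ge0 M.+1 dh; have hk0 := sum_moment_ge0 M.+1 (decr2_mul dh dk).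
  move: (m0); rewrite le_eqVlt => /predU1P[z|mp].
    have hz (j : 'I_M.+1) : h j = 0.
      have /eqP := esym z; rewrite psumr_eq0; last by move=> i _; exact: moment_ge0.
      move=> /allP /(_ j (mem_index_enum _)) /=.
      by rewrite /moment !mulf_eq0 (gt_eqF (two_sided_gt0 _ _)) (gt_eqF (quad_gt0 _ _)) => /eqP.
    rewrite [leLHS](_ : _ = 0) ?mulr_ge0 //.
    have : \sum_(j < M.+1) drift h j = 0.
      by rewrite dr // big1 ?mulr0 // => j _; rewrite hz mulr0.
    move=> /eqP; rewrite psumr_eq0; last by move=> i _; exact: drift_ge0.
    move=> /allP dz; rewrite big1 // => j _.
    by have /= /eqP -> := dz j (mem_index_enum _); rewrite mul0r.
  rewrite -(ler_pM2r mp) (le_trans cs) // [leRHS]mulrAC ler_wpM2r //.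
  by rewrite -mulrA ler_wpM2l.
have tM h : (forall j, (N1 + N2 <= j)%N -> h j = 0) ->
   \sum_(j < M.+1) moment h j = \sum_(j < M) moment h j.
  by move=> h0; apply: (@sum_widen _ (moment h) M) => // j Mj; rewrite /moment h0 ?mulr0 // Mge.
have tS h : (forall j, (N1 + N2 <= j)%N -> h j = 0) ->
   \sum_(j < M.+1) two_sided R j * h j = \sum_(j < M) two_sided R j * h j.
  by move=> h0; apply: (@sum_widen _ (fun j => two_sided R j * h j) M) => // j Mj; rewrite h0 ?mulr0 // Mge.
have hf := half f g s b1 s0 df dg sf pf zf; rewrite tM // tS // in hf.
have hg := half g f t b2 t0 dg df sg pg zg; rewrite tM // tS // in hg.
have {}hf := hf fM; have {}hg := hg gM.
have comm : \sum_(j < M.+1) moment (fun j => g j * f j) j = T.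
  by rewrite -TE; apply: eq_bigr => j _; rewrite /moment [g j * f j]mulrC.
rewrite TE in hf; rewrite comm in hg; rewrite SE in pq; lra.
Qed.

Lemma spread_mul f g s t : spread f s -> spread g t ->
  spread (fun k => f k * g k) (s + t).
Proof.
move=> Sf Sg; have [s0 df sf hf] := Sf; have [t0 dg sg hg] := Sg.
have [f0 _] := df; have [g0 _] := dg.
case: hf => [hf|hf].
  apply: spread_eq (spread_weaken (spread_scale (f0 0%N) Sg) _) => [k|].
    by rewrite hf.
  by rewrite lerDr.
case: hg => [hg|hg].
  apply: spread_eq (spread_weaken (spread_scale (g0 0%N) Sf) _) => [k|].
    by rewrite hg mulrC.
  by rewrite lerDl.
split; [exact: addr_ge0|exact: decr2_mul|exact: starlike_mul|right].
exact: confined_mul.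
Qed.

(** With mass [S] and moment [T], the neighbour sum has mass [2 * S] and moment [2 * (T + S)], and
    [S <= s * T] gives [(1 + s) * S <= s * (T + S)]. A unit resistor is thus added in series. *)
Lemma spread_nbr_sum f s : spread f s -> spread (nbr_sum f) (s / (1 + s)).
Proof.
move=> [s0 df sf h]; have s1 : 0 < 1 + s by lra.
split; [exact: divr_ge0 s0 (ltW s1)|exact: decr2_nbr_sum|exact: starlike_nbr_sum|].
case: h => [h|[N [b [f0 pf fs]]]].
  by left => -[|k] //=; rewrite !h mulr2n.
right; exists N.+2, (~~ b); split.
- by move=> [|[|j]] //= Nj; rewrite !f0 ?addr0 //; lia.
- move=> [|j] /= jb; first by rewrite pf ?mul0rn //; case: (b) jb.
  by rewrite !pf ?addr0 //=; case: (b) jb; case: (odd j).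
have E0 : f N.+1 = 0 /\ f N.+2 = 0 by split; rewrite f0 // ?leqW.
rewrite sum_nbr_sum /moment sum_quad_nbr_sum; case: E0 => -> ->.
have := @confined_widen s f N.+2 (ex_intro _ N (ex_intro _ b (And4 _ f0 pf fs))).
rewrite /moment => /(_ (leqW (leqnSn _))).
set S := \sum_(_ < _) _; set T := \sum_(_ < _) _ => ST.
rewrite !mulr0 !addr0 !subr0 mulrAC ler_pdivlMr //; lra.
Qed.

End Spread.

(** * Small mass near zero for weights of large variance *)

Section Growth.
Variable R : realType.
Implicit Types f : nat -> R.

Lemma sum_moment_eq0 f N : decr2 f -> \sum_(j < N) moment f j = 0 ->
  forall j, (j < N)%N -> f j = 0.
Proof.
move=> df /eqP; rewrite psumr_eq0; last by move=> i _; exact: moment_ge0.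
move=> /allP fz j jN; have /= := fz (Ordinal jN) (mem_index_enum _).
by rewrite /moment !mulf_eq0 (gt_eqF (two_sided_gt0 _ _)) (gt_eqF (quad_gt0 _ _)) => /eqP.
Qed.

Lemma quad_le i j : (i <= j)%N -> quad R i <= quad R j.
Proof. by move=> ij; rewrite lerD2r lerXn2r ?nnegrE ?ler_nat. Qed.

Section FixedProfile.
Variables (f : nat -> R) (s : R) (N : nat) (b : bool).
Hypotheses (s0 : 0 <= s) (df : decr2 f) (sf : starlike f).
Hypothesis f0 : forall j, (N <= j)%N -> f j = 0.
Hypothesis pf : parity_supported b f.
Hypothesis fs : \sum_(j < N) two_sided R j * f j <= s * \sum_(j < N) moment f j.

Let F m := \sum_(j < m.+1) two_sided R j * f j.

Lemma mass_ge0 m : 0 <= F m.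
Proof.
apply: sumr_ge0 => j _; apply: mulr_ge0; first exact/ltW/two_sided_gt0.
by have [-> ] := df.
Qed.

(** Chebyshev's inequality with [q] the indicator of [j <= m] bounds the truncated sum of the drift
    by [2 * s * quad R m * F m], hence by [F m]. By [sum_drift1] that sum is at least
    [2 * F m - 2 * (m + 1) * f m]. *)
Lemma mass_le_top m : odd m = b -> s * quad R m <= 1 / 2 ->
  F m <= 2 * (m%:R + 1) * f m.
Proof.
move=> mb sm; have [fge0 fd] := df.
pose M := (N + m).+1; pose q j : R := (j <= m)%N%:R.
have NM : (N <= M.+1)%N by rewrite /M; lia.
have mM : (m.+1 <= M.+1)%N by rewrite /M; lia.
have f1 : f m.+1 = 0 by rewrite pf //= mb; case: (b).
have fp : m%:R * f m.-1 = 0.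
  by case: (m) mb => [|k] /= kb; rewrite ?mul0r // pf ?mulr0 // -kb; case: odd.
have fmm := @confined_widen R s f M.+1
  (ex_intro _ N (ex_intro _ b (And4 NM f0 pf fs))).
have qd j : q j.+2 <= q j.
  by rewrite /q ler_nat; case: (ltnP j.+1 m) => //= /ltnW/ltnW ->.
have cs := sum_drift_chebyshev M.+1 df sf pf qd.
have dr : \sum_(j < M.+1) drift f j = 2 * \sum_(j < M.+1) two_sided R j * f j.
  by rewrite sum_drift1 !f0 ?addr0 ?mulr0 ?subr0 // /M /= ?leqW ?leq_addr.
have cutE (h : nat -> R) : \sum_(j < M.+1) h j * q j = \sum_(j < m.+1) h j.
  rewrite (big_ord_widen _ h mM) [RHS]big_mkcond /=.
  by apply: eq_bigr => j _; rewrite /q ltnS; case: leqP; rewrite (mulr0, mulr1).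
rewrite !cutE dr in cs.
have mq : \sum_(j < m.+1) moment f j <= quad R m * F m.
  rewrite mulr_sumr ler_sum // => j _; rewrite /moment mulrAC mulrC.
  apply: ler_wpM2r; last by rewrite quad_le // -ltnS.
  by apply: mulr_ge0 => //; exact/ltW/two_sided_gt0.
have B0 := sum_moment_ge0 M.+1 df.
move: (B0); rewrite le_eqVlt => /predU1P[/esym z|Bp].
  have fz j : (j <= m)%N -> f j = 0.
    by move=> jm; apply: (sum_moment_eq0 df z); rewrite ltnS (leq_trans jm) // /M; lia.
  by rewrite /F big1 ?fz ?mulr0 // => j _; rewrite fz ?mulr0 // -ltnS.
have key : \sum_(j < m.+1) drift f j <= 2 * s * (quad R m * F m).
  rewrite -(ler_pM2r Bp) (le_trans cs) //.
  apply: (@le_trans _ _ (2 * (s * \sum_(j < M.+1) moment f j) * (quad R m * F m))).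
    apply: ler_pM => //; last by rewrite ler_wpM2l.
      by rewrite mulr_ge0 // sumr_ge0 // => j _; rewrite mulr_ge0 // ltW ?two_sided_gt0.
    exact: sum_moment_ge0.
  by apply: eq_imp_le; ring.
have Fm := mass_ge0 m; have h1 := ler_wpM2r Fm sm.
have h2 := ler_wpM2l (ler0n R m.+1) (fd m).
rewrite sum_drift1 -/(F m) f1 addr0 fp subr0 in key; rewrite -natr1 in h2.
lra.
Qed.

(** Since [F (m + 2) = F m + 2 * f (m + 2)], [mass_le_top] at [m + 2] gives
    [F m * (m + 3) <= F (m + 2) * (m + 2)]. Squaring and [(m + 2) * (m + 4) <= (m + 3) ^ 2] show
    that the mass grows at least like a square root. *)
Lemma mass_step m : odd m = b -> s * quad R m.+2 <= 1 / 2 ->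
  F m ^+ 2 * (m%:R + 4) <= F m.+2 ^+ 2 * (m%:R + 2).
Proof.
move=> mb sm; have := @mass_le_top m.+2; rewrite /= negbK => /(_ mb sm).
have FE : F m.+2 = F m + 2 * f m.+2.
  rewrite /F big_ord_recr big_ord_recr /= pf ?mulr0 ?addr0 //= mb; by case: (b).
have F0 := mass_ge0 m; have F2 := mass_ge0 m.+2.
have m0 := ler0n R m; rewrite -[m.+2%:R]natr1 -[m.+1%:R]natr1.
move: FE; set x := F m in F0 *; set y := F m.+2 in F2 *; set n : R := m%:R in m0 *.
move=> yE h; have h1 : x * (n + 3) <= y * (n + 2) by rewrite yE in h *; lra.
have h2 : (x * (n + 3)) ^+ 2 <= (y * (n + 2)) ^+ 2.
  by apply: lerXn2r => //; rewrite nnegrE mulr_ge0 //; lra.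
have n2 : 0 < n + 2 by lra.
rewrite -(ler_pM2r n2); have := mulr_ge0 F0 F0; lra.
Qed.

Lemma mass_chain a i : odd a = b -> s * quad R (a + i.*2) <= 1 / 2 ->
  F a ^+ 2 * ((a + i.*2)%:R + 2) <= F (a + i.*2) ^+ 2 * (a%:R + 2).
Proof.
move=> ab; elim: i => [|i IH]; first by rewrite addn0.
rewrite doubleS !addnS; set c := (a + i.*2)%N in IH * => sm.
have {}IH : F a ^+ 2 * (c%:R + 2) <= F c ^+ 2 * (a%:R + 2).
  by apply: IH; apply: le_trans sm; rewrite ler_wpM2l // quad_le // leqW.
have st : F c ^+ 2 * (c%:R + 4) <= F c.+2 ^+ 2 * (c%:R + 2).
  by apply: mass_step => //; rewrite /c oddD odd_double addbF.
have c2 : 0 < c%:R + 2 :> R by rewrite ltr_wpDl.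
have c4 : 0 <= c%:R + 4 :> R by rewrite addr_ge0.
have a2 : 0 <= a%:R + 2 :> R by rewrite addr_ge0.
rewrite -(ler_pM2r c2); have := ler_wpM2r c4 IH; have := ler_wpM2r a2 st.
rewrite -[c.+2%:R]natr1 -[c.+1%:R]natr1; lra.
Qed.

End FixedProfile.

Lemma spread_thin (A : nat) (eps : R) : 0 < eps -> exists2 d : R, 0 < d &
  forall f s N, spread f s -> s <= d -> (forall j, (N <= j)%N -> f j = 0) ->
  \sum_(j < N) two_sided R j * ((j <= A)%N%:R * f j) <=
  eps * \sum_(j < N) two_sided R j * f j.
Proof.
(* With [eps ^ 2 * i >= A + 3], the linear growth of the squared mass over [i] double steps gains a
   factor [eps ^ -2]. *)
move=> e0; pose i := (Num.truncn (A.+3%:R / eps ^+ 2)).+1.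
have iE : A.+3%:R <= eps ^+ 2 * i%:R.
  rewrite mulrC -ler_pdivrMr ?exprn_gt0 // ltW //.
  by rewrite /i truncnS_gt.
(* This bound on [s] ensures [s * quad R j <= 1 / 2] for all [j <= m], as [mass_chain] requires. *)
pose m := (A.+1 + i.*2)%N; exists (1 / 2 / quad R m).
  by rewrite divr_gt0 ?quad_gt0.
move=> f s N [s0 df sf [fc|[N1 [b [f0 pf fs]]]]] sd fN.
  have fz j : f j = 0 by rewrite fc -(fc N) fN.
  rewrite big1 ?mulr_ge0 ?sumr_ge0 ?(ltW e0) // => j _; rewrite fz ?mulr0 //.
(* Below, [a] is [A] rounded up to the parity of the support of [f]. *)
have [fge0 _] := df.
pose a := if odd A == b then A else A.+1.
have ab : odd a = b by rewrite /a; case: eqVneq => //=; case: (odd A); case: (b).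
have aA : (A <= a <= A.+1)%N by rewrite /a; case: ifP; rewrite leqnn leqnSn.
have /andP[Aa aA1] := aA.
have am : (a + i.*2 <= m)%N by rewrite leq_add2r.
have sq : s * quad R (a + i.*2) <= 1 / 2.
  rewrite -ler_pdivlMr ?quad_gt0 // (le_trans sd) // ler_pM2l //.
  by rewrite lef_pV2 ?posrE ?quad_gt0 // quad_le.
have := mass_chain s0 df sf f0 pf fs ab sq.
set Fa := \sum_(j < a.+1) _; set Fm := \sum_(j < _.+1) _ => ch.
have ts0 j : 0 <= two_sided R j * f j by rewrite mulr_ge0 // ltW ?two_sided_gt0.
have Fa0 : 0 <= Fa by exact: sumr_ge0.
have Fm0 : 0 <= Fm by exact: sumr_ge0.
have hF : Fa <= eps * Fm.
  have am0 : 0 < (a + i.*2)%:R + 2 :> R by rewrite ltr_wpDl.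
  rewrite -(@ler_pXn2r _ 2) ?nnegrE ?mulr_ge0 ?(ltW e0) //.
  rewrite -(ler_pM2r am0) (le_trans ch) //.
  have k : a%:R + 2 <= eps ^+ 2 * ((a + i.*2)%:R + 2).
    have : a%:R <= A.+1%:R :> R by rewrite ler_nat.
    have : 0 <= eps ^+ 2 * (a%:R + 2 + i%:R) by rewrite mulr_ge0 ?sqr_ge0 ?addr_ge0.
    move: iE; rewrite natrD -addnn natrD.
    rewrite -[A.+3%:R]natr1 -[A.+2%:R]natr1 -[A.+1%:R]natr1; lra.
  by apply: (le_trans (ler_wpM2l (sqr_ge0 Fm) k)); apply: eq_imp_le; ring.
have widen k (g : nat -> R) : (forall j, 0 <= g j) -> (forall j, (N <= j)%N -> g j = 0) ->
    \sum_(j < k) g j <= \sum_(j < N) g j.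
  move=> g0 gN; rewrite -(@sum_widen _ g N (N + k)) ?leq_addr //.
  rewrite (big_ord_widen _ g (leq_addl N k)) [leLHS]big_mkcond /=.
  by apply: ler_sum => j _; case: ifP.
have hm : Fm <= \sum_(j < N) two_sided R j * f j.
  by apply: (widen _ (fun j => two_sided R j * f j)) => // j /fN ->; rewrite mulr0.
apply: (@le_trans _ _ Fa); last first.
  by rewrite (le_trans hF) // ler_wpM2l // ltW.
pose g j := two_sided R j * ((j <= A)%N%:R * f j).
have -> : \sum_(j < N) two_sided R j * ((j <= A)%N%:R * f j) = \sum_(j < N + a.+1) g j.
  by symmetry; apply: (@sum_widen _ g) => [|j /fN h]; rewrite ?leq_addr // /g h !mulr0.
rewrite (@sum_widen _ g a.+1) ?leq_addl //; last first.
  by move=> j ja; rewrite /g leqNgt (leq_ltn_trans Aa ja) mul0r mulr0.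
apply: ler_sum => j _; rewrite /g; case: leqP => _; rewrite ?mul1r //.
by rewrite mul0r mulr0.
Qed.

End Growth.

(** * Weights with Gaussian-like decay *)

Section Decay.
Variable R : realType.
Implicit Types f g : nat -> R.

Definition decay f (c : R) : Prop :=
  [/\ 0 <= c, forall k, 0 <= f k & forall k, f k.+2 <= expR (- c) ^+ k.+1 * f k].

Lemma decay_const : decay (fun=> 1) 0.
Proof. by split=> // k; rewrite oppr0 expR0 expr1n mul1r. Qed.

Lemma decay_delta : decay (fun j => (j == 0%N)%:R) 1.
Proof. by split=> // k; rewrite mulr_ge0 ?exprn_ge0 ?expR_ge0. Qed.

Lemma decay_weaken f c d : decay f c -> 0 <= d <= c -> decay f d.
Proof.
move=> [c0 f0 fc] /andP[d0 dc]; split=> // k.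
apply: le_trans (fc k) _; apply: ler_wpM2r => //.
by apply: lerXn2r; rewrite ?nnegrE ?expR_ge0 // ler_expR lerN2.
Qed.

Lemma decay_mul f g c d : decay f c -> decay g d -> decay (fun k => f k * g k) (c + d).
Proof.
move=> [c0 f0 fc] [d0 g0 gd]; split=> [|k|k]; [exact: addr_ge0|exact: mulr_ge0|].
by rewrite opprD expRD exprMn mulrACA; apply: ler_pM.
Qed.

(** The ratios of the neighbour sum are at most those of the exact profile, hence at most powers of
    [(1 + t ^ 2) / 2]. As [exp (2 * c) >= 1 + 2 * c], this base is at most [1 - c / (1 + 2 * c)],
    which is below the required exponential. *)
Lemma decay_nbr_sum f c : decay f c -> decay (nbr_sum f) (c / (1 + 2 * c)).
Proof.
move=> [c0 f0 fc]; have c1 : 0 < 1 + 2 * c by lra.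
split=> [|k|]; [exact: divr_ge0 c0 (ltW c1)|exact: nbr_sum_ge0|].
set t := expR (- c) in fc *; set r := expR _.
have t01 : 0 < t <= 1 by rewrite expR_gt0 -[leRHS]expR0 ler_expR lerNl oppr0.
have [t0 t1] := andP t01.
have tr : (1 + t ^+ 2) / 2 <= r.
  apply: (@le_trans _ _ (1 - c / (1 + 2 * c))); last first.
    exact: expR_ge1Dx.
  have t2 : t ^+ 2 <= (1 + 2 * c)^-1.
    rewrite /t -expRM_natl mulrN expRN lef_pV2 ?posrE ?expR_gt0 //.
    exact: expR_ge1Dx.
  have -> : 1 - c / (1 + 2 * c) = (1 + (1 + 2 * c)^-1) / 2.
    by field; rewrite gt_eqF.
  by rewrite ler_pM2r ?invr_gt0 // lerD2l.
have Gr m : gauss_ratio t m <= r ^+ m.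
  apply: le_trans (gauss_ratio_power t01 m) _.
  by apply: lerXn2r; rewrite ?nnegrE ?expR_ge0 // divr_ge0 ?addr_ge0 ?exprn_ge0 ?(ltW t0).
case=> [|k].
  rewrite /= expr1; have := fc 1%N; have := ler_wpM2r (f0 1%N) tr; lra.
apply: (@le_trans _ _ (gauss_ratio t k.+2 * nbr_sum f k.+1)); last first.
  by apply: ler_wpM2r; [exact: nbr_sum_ge0|exact: Gr].
have p1 : 0 < 1 + t ^+ k.+1 by rewrite addr_gt0 ?exprn_gt0.
rewrite gauss_ratioS // mulrAC ler_pdivlMr //=.
have a := fc k.+2; have h := fc k; have p0 := ltW p1.
have p3 : 0 <= 1 + t ^+ k.+3 by rewrite addr_ge0 ?exprn_ge0 ?(ltW t0).
have h1 := ler_wpM2r p0 a; have h2 := ler_wpM2r p3 h; lra.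
Qed.

(** For [j > n] one has [f j <= exp (- c * n) * f (j - 2)], and the shifted values sum to at most
    the mass. The choice of [n] makes [2 * exp (- c * n) <= eps], where [2] bounds [two_sided]. *)
Lemma decay_tail (c eps : R) : 0 < c -> 0 < eps -> exists M, forall f N, decay f c ->
  \sum_(j < N) two_sided R j * ((M <= j)%N%:R * f j) <=
  eps * \sum_(j < N) two_sided R j * f j.
Proof.
move=> c0 e0; pose n := (Num.truncn (2 / eps / c)).+1.
have tn : 2 * expR (- c) ^+ n <= eps.
  rewrite -expRM_natl mulrN expRN ler_pdivrMr ?expR_gt0 //.
  rewrite -ler_pdivrMl // mulrC (le_trans _ (expR_ge1Dx _)) //.
  by rewrite ler_wpDl // -ler_pdivrMr // ltW // truncnS_gt.
exists n.+1 => f N [_ f0 fc]; set t := expR (- c) in tn fc.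
have t01 : 0 <= t <= 1 by rewrite expR_ge0 -[leRHS]expR0 ler_expR lerNl oppr0 ltW.
have [t0 t1] := andP t01.
have ts j : 1 <= two_sided R j <= 2 by case: j => [|j] /=; rewrite ?lexx ?ler1n.
apply: (@le_trans _ _ (\sum_(j < N) eps * ((2 <= j)%N%:R * f (j - 2)%N))).
  apply: ler_sum => j _; have [nj|_] := leqP n.+1 j; last first.
    by rewrite mul0r mulr0 !mulr_ge0 // ltW.
  have j2 : (2 <= j)%N by rewrite (leq_trans _ nj).
  rewrite mul1r j2 mul1r; have := fc (j - 2)%N.
  rewrite (_ : (j - 2).+2 = j)%N => [h|]; last by rewrite -addn2 subnK.
  apply: (@le_trans _ _ (2 * f j)); first by apply: ler_wpM2r => //; case/andP: (ts j).
  apply: (@le_trans _ _ (2 * (t ^+ n * f (j - 2)%N))).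
    rewrite ler_wpM2l // (le_trans h) // ler_wpM2r //.
    by rewrite ler_wiXn2l //; lia.
  by rewrite mulrA ler_wpM2r.
rewrite -mulr_sumr ler_wpM2l ?(ltW e0) //.
apply: (@le_trans _ _ (\sum_(j < N) f j)); last first.
  by apply: ler_sum => j _; rewrite ler_peMl //; case/andP: (ts j).
case: N => [|[|N]]; first by rewrite !big_ord0.
  by rewrite !big_ord1 mul0r.
have -> : \sum_(j < N.+2) (2 <= j)%N%:R * f (j - 2)%N = \sum_(j < N) f j.
  elim: N => [|N IH]; first by rewrite big_ord_recr !big_ord1 big_ord0 /= !mul0r addr0.
  by rewrite big_ord_recr IH [RHS]big_ord_recr /= mul1r subSS subSS subn0.
by rewrite !big_ord_recr /= -addrA lerDl addr_ge0.
Qed.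

End Decay.

(** * Rooted trees *)

Section Tree.
Variables (V : choiceType) (e : rel V).
Hypotheses (Vlf : locally_finite e) (Vtree : is_tree e).

Lemma edge_sym x y : e x y = e y x.
Proof. by case: Vtree => [[es _] _ _]; exact: es. Qed.

Lemma edge_irr x : e x x = false.
Proof. by case: Vtree => [[_ ei] _ _]; exact: ei. Qed.

Lemma in_nbrs x y : (y \in nbrs e x) = e x y.
Proof. by rewrite in_fset_set ?Vlf // mem_setE. Qed.

Lemma nbrs_neq0 x : infinite_set [set: V] -> (0 < #|` nbrs e x|)%N.
Proof.
move=> Vinf; rewrite cardfs_gt0; apply/fset0Pn.
have [y yx] : exists y, y <> x.
  apply: contrapT => /forallNP h; apply: Vinf.
  suff -> : [set: V] = [set x] by exact: finite_set1.
  by apply/seteqP; split=> // z _ /=; apply: contrapT => /(h z).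
case: Vtree => _ ec _; have [[|z p] /= []] := ec x y.
  by move=> _ xy; case: yx.
by case/andP=> xz _ _; exists z; rewrite in_nbrs.
Qed.

Lemma dist_walk x y : walk_length e x y (dist e x y) /\
  forall m, walk_length e x y m -> (dist e x y <= m)%N.
Proof.
have [p [pp pl]] : exists p, path e x p /\ last x p = y by case: Vtree.
have ex : exists n, `[< walk_length e x y n >].
  by exists (size p); apply/asboolP; exists p.
rewrite /dist; apply: (xgetPex 0%N (P := fun n => walk_length e x y n /\
  forall m, walk_length e x y m -> (n <= m)%N)).
case: (ex_minnP ex) => n /asboolP wn nmin; exists n; split=> // m wm.
by apply: nmin; apply/asboolP.
Qed.

Lemma dist_self x : dist e x x = 0%N.
Proof.
by apply/eqP; rewrite -leqn0; have [_] := dist_walk x x; apply; exists [::].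
Qed.

Section Rooted.
Variable v : V.

Local Notation depth := (dist e v).

Lemma depth_edge x y : e x y -> (depth y <= (depth x).+1)%N.
Proof.
move=> xy; have [[p [pp pl ps]] _] := dist_walk v x.
have [_ h] := dist_walk v y; apply: h; exists (rcons p y).
by rewrite rcons_path pp pl xy last_rcons size_rcons ps.
Qed.

(** The root is its own parent; elsewhere the set is nonempty by connectedness, so the default [v]
    never serves. *)
Definition parent x : V :=
  if x == v then v else xget v [set y | e y x /\ (depth y).+1 = depth x].

Lemma parent_root : parent v = v.
Proof. by rewrite /parent eqxx. Qed.

Lemma parentP x : x != v -> e x (parent x) /\ (depth (parent x)).+1 = depth x.
Proof.
move=> xv; rewrite /parent (negPf xv).
suff ex : exists y, e y x /\ (depth y).+1 = depth x.
  have [a b] := xgetPex v (P := fun y => e y x /\ (depth y).+1 = depth x) ex.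
  by split=> //; rewrite edge_sym.
have [[p [pp pl ps]] xmin] := dist_walk v x.
case/lastP: p pp pl ps => [|p z]; first by move=> _ /= vx; rewrite vx eqxx in xv.
rewrite rcons_path last_rcons size_rcons => /andP[pp pe] zx ps.
rewrite zx in pe; exists (last v p); split=> //.
apply/eqP; rewrite eqn_leq depth_edge // andbT -ps ltnS.
by have [_] := dist_walk v (last v p); apply; exists p.
Qed.

Lemma parent_neq x : x != v -> parent x != x.
Proof.
by move=> /parentP[xp _]; apply/eqP => E; rewrite E edge_irr in xp.
Qed.

(* Otherwise the paths from [x] and [y] to the root would connect [x] to [y]
   without using the edge [xy], which would thus lie on a cycle. *)
Lemma edge_parent x y : e x y -> y = parent x \/ x = parent y.
Proof.
move=> xy; apply: contrapT => /not_orP[yx xy'].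
pose e' a b := e a b && ~~ ((a == x) && (b == y) || (a == y) && (b == x)).
have e's a b : e' a b = e' b a.
  by rewrite /e' edge_sym; congr (_ && ~~ _); rewrite orbC ![(a == _) && _]andbC.
have toroot z : exists p, path e' z p /\ last z p = v.
  have [n] := ubnP (depth z); elim: n z => // n IH z zn.
  have [->|zv] := eqVneq z v; first by exists [::].
  have [zp dz] := parentP zv.
  have [|p [pp pl]] := IH (parent z); first by rewrite -ltnS dz.
  exists (parent z :: p); split=> //=; rewrite pp andbT /e' zp /=.
  apply/negP => /orP[] /andP[/eqP zE /eqP pE].
    by apply: yx; rewrite -zE pE.
  by apply: xy'; rewrite -zE pE.
have [p1 [pp1 pl1]] := toroot x; have [p2 [pp2 pl2]] := toroot y.
have [p [pp pl]] : exists p, path e' x p /\ last x p = y.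
  have [p3 [pp3 pl3]] : exists p, path e' v p /\ last v p = y.
    exists (rev (belast y p2)); split.
      rewrite -pl2 rev_path; apply: sub_path pp2 => a b; by rewrite e's.
    by case: (p2) => [|a s] in pl2 *; rewrite ?pl2 //= rev_cons last_rcons.
  by exists (p1 ++ p3); rewrite cat_path pp1 last_cat pl1.
move: pl; case/shortenP: pp => q qp qu _ ql.
have cyc : ucycle e (x :: q).
  rewrite /ucycle qu andbT /= rcons_path ql edge_sym xy andbT.
  by apply: sub_path qp => a b /andP[].
have [_ _ ac] := Vtree; have := ac _ cyc.
case: q qp ql {qu cyc} => [|z [|z' q]] //= qp ql _.
  by rewrite ql edge_irr in xy.
by move: qp; rewrite ql andbT /e' !eqxx /= andbF.
Qed.

Lemma child_parent x y : e x y -> y != parent x -> y != v /\ parent y = x.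
Proof.
move=> xy yx; have [E|->] := edge_parent xy; first by rewrite E eqxx in yx.
split=> //; apply/eqP => yv; have [E|E] := edge_parent xy.
  by rewrite E eqxx in yx.
by rewrite E yv parent_root edge_irr in xy.
Qed.

Lemma child_edge y : y != v -> e (parent y) y /\ y != parent (parent y).
Proof.
move=> yv; have [yp dy] := parentP yv; rewrite edge_sym; split=> //.
have [pv|pv] := eqVneq (parent y) v; first by rewrite pv parent_root.
have [_ dp] := parentP pv; apply/eqP => E; move: dy dp; rewrite -E => <- /eqP.
by rewrite -addn2 -{2}[dist _ _ _]addn0 eqn_add2l.
Qed.

Section Domain.
Variable L : {fset V}.
Hypotheses (vL : v \in L) (Lconn : connected_in e L).

Lemma in_boundary y : (y \in boundary e L) = (y \notin L) && has (e^~ y) L.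
Proof.
rewrite in_fset_set.
  apply/idP/andP => [/set_mem[yL [x xL xy]]|[yL /hasP[x xL xy]]].
    by split=> //; apply/hasP; exists x.
  by apply/mem_set; split=> //; exists x.
apply: (@sub_finite_set _ _ (\bigcup_(x in [set` L]) [set y | e x y])).
  by move=> z [_ [x xL xz]]; exists x.
by apply: bigcup_finite => // x _; exact: Vlf.
Qed.

(** If [parent x] were outside [L], a path in [L] from [x] could never leave the descendants of [x],
    the set [D] below, and so could not reach the root. *)
Lemma parent_in x : x \in L -> parent x \in L.
Proof.
move=> xL; apply: contrapT => /negP pL.
have xv : x != v by apply/eqP => E; rewrite E parent_root vL in pL.
have [p [pp pl pa]] := Lconn xL vL.
pose D z := exists i, iter i parent z = x.
have Dstep z z' : D z -> e z z' -> z' \in L -> D z'.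
  move=> [i iz] zz' z'L; have [E|E] := edge_parent zz'; last first.
    by exists i.+1; rewrite iterSr -E.
  case: i iz => [|i] iz; first by move: iz z'L; rewrite /= E => ->; rewrite (negPf pL).
  by exists i; rewrite E -iterSr.
have Dall q z : D z -> path e z q -> all (mem L) q -> D (last z q).
  elim: q z => //= a q IH z Dz /andP[za qp] /andP[aL qa].
  exact: IH (Dstep _ _ Dz za aL) qp qa.
have [i] : D v by rewrite -pl; apply: Dall => //; exists 0%N.
suff -> : iter i parent v = v by move=> E; rewrite E eqxx in xv.
by elim: i => //= i ->; rewrite parent_root.
Qed.

Lemma parent_in_boundary x : x \in boundary e L -> x != v /\ parent x \in L.
Proof.
rewrite in_boundary => /andP[xL /hasP[z zL zx]].
have xv : x != v by apply/eqP => E; rewrite E vL in xL.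
split=> //; have [E|<-//] := edge_parent zx.
by rewrite E parent_in in xL.
Qed.

Lemma nbrs_in_domain x y : x \in L -> e x y -> y \in closed_domain e L.
Proof.
move=> xL xy; rewrite inE in_boundary; have [//|yL /=] := boolP (y \in L).
by apply/hasP; exists x.
Qed.

Lemma in_domain x : (x \in closed_domain e L) = (x \in L) || (x \in boundary e L).
Proof. by rewrite inE. Qed.

Lemma parent_in_domain x : x \in closed_domain e L -> parent x \in L.
Proof.
rewrite in_domain => /orP[/parent_in//|/parent_in_boundary[]//].
Qed.

End Domain.
End Rooted.
End Tree.

(** * Counting homomorphisms by leaf elimination *)

(** The integers of absolute value below [n], outermost pair first: [Negz l] is the opposite of
    [m = l + 1]. *)
Fixpoint ints (n : nat) : seq int :=
  if n is m.+1 then (if m is l.+1 then [:: Posz m, Negz l & ints m] else [:: 0])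
  else [::].

Lemma ints_step n : ints n.+2 = [:: Posz n.+1, Negz n & ints n.+1].
Proof. by []. Qed.

Lemma mem_ints n k : (k \in ints n) = (`|k| < n)%N.
Proof.
elim: n k => [|[|n] IH] k //; first by rewrite inE; case: k => [[|k]|k].
rewrite ints_step !inE IH; case: k => k.
  have -> : (Posz k == Posz n.+1) = (k == n.+1) by [].
  by rewrite (_ : (Posz k == Negz n) = false) //= [RHS]ltnS [RHS]leq_eqVlt.
have -> : (Negz k == Posz n.+1) = false by [].
have -> : (Negz k == Negz n) = (k == n) by [].
by rewrite /= !ltnS [RHS]leq_eqVlt.
Qed.

Lemma uniq_ints n : uniq (ints n).
Proof.
elim: n => [|[|n] IH] //; rewrite ints_step !cons_uniq IH.
by rewrite in_cons !mem_ints /= !ltnn.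
Qed.

Lemma sum_ints (R : realFieldType) (F : nat -> R) n :
  \sum_(k <- ints n) F `|k|%N = \sum_(j < n) two_sided R j * F j.
Proof.
elim: n => [|[|n] IH]; first by rewrite big_nil big_ord0.
  by rewrite big_seq1 big_ord1 mul1r.
by rewrite ints_step !big_cons IH [RHS]big_ord_recr /=; ring.
Qed.

Lemma nbr_sum_absz (R : realFieldType) (f : nat -> R) (a : int) :
  f `|(a + 1)%R|%N + f `|(a - 1)%R|%N = nbr_sum f `|a|%N.
Proof.
case: a => [[|n]|n]; first by rewrite /= mulr2n.
  have -> : `|(Posz n.+1 + 1)%R|%N = n.+2 by lia.
  have -> : `|(Posz n.+1 - 1)%R|%N = n by lia.
  by rewrite addrC.
have -> : `|(Negz n + 1)%R|%N = n by lia.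
by have -> : `|(Negz n - 1)%R|%N = n.+2 by lia.
Qed.

Section Counting.
Variables (R : realType) (V : choiceType) (e : rel V).
Hypotheses (Vlf : locally_finite e) (Vtree : is_tree e).
Variable v : V.

Local Notation depth := (dist e v).
Local Notation par := (parent e v).

(* [r] lists vertices, the last one to be explored first: each vertex comes
   before its parent. *)
Fixpoint exploration (r : seq V) : bool :=
  if r is x :: r' then
    [&& x != v, x \notin r', par x \in v :: r' & exploration r']
  else true.

Lemma exploration_notin r : exploration r -> v \notin r.
Proof.
elim: r => //= x r IH /and4P[xv _ _ /IH]; rewrite in_cons negb_or => ->.
by rewrite eq_sym xv.
Qed.

Lemma exploration_uniq r : exploration r -> uniq (v :: r).
Proof.
move=> er; rewrite /= exploration_notin //.
by elim: r er => //= x r IH /and4P[_ -> _ /IH].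
Qed.

Lemma exploration_parent r x : exploration r -> x \in r -> par x \in v :: r.
Proof.
elim: r => //= y r IH /and4P[_ _ py er]; rewrite [x \in _]in_cons.
have sub z : z \in v :: r -> z \in [:: v, y & r].
  by rewrite !in_cons => /orP[->//|->]; rewrite !orbT.
by case/predU1P => [->|xr]; [exact: sub py|exact: sub (IH er xr)].
Qed.

(** Children precede parents in [r], so [w x] already contains the contributions of the children of
    [x] listed in [r] when [x] is removed. *)
Fixpoint eliminate (w : V -> nat -> R) (r : seq V) : nat -> R :=
  if r is x :: r' then
    eliminate (fun z => if z == par x then fun k => w z k * nbr_sum (w x) k else w z) r'
  else w v.

Section Domain.
Variable D : {fset V}.
Hypothesis vD : v \in D.

Implicit Types phi : {ffun D -> int}.

Definition update phi x (a : int) : {ffun D -> int} :=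
  [ffun z => if val z == x then a else phi z].

Lemma heightE phi (z : D) : height phi (val z) = phi z.
Proof. by rewrite /height valK. Qed.

Lemma height_update phi x a z : x \in D ->
  height (update phi x a) z = if z == x then a else height phi z.
Proof.
move=> xD; rewrite /height; case: insubP => [u _ <-|zD] /=; first by rewrite ffunE.
by case: eqP => // zx; rewrite zx xD in zD.
Qed.

Definition root_only (k : int) : {ffun D -> int} :=
  [ffun z => if val z == v then k else 0].

Lemma height_root_only k z : height (root_only k) z = if z == v then k else 0.
Proof.
rewrite /height; case: insubP => [u _ <-|zD] /=; first by rewrite ffunE.
by case: eqP => // zv; rewrite zv vD in zD.
Qed.

Lemma height_ext phi psi :
  (forall z, z \in D -> height phi z = height psi z) -> phi = psi.
Proof. by move=> h; apply/ffunP => z; rewrite -!heightE h ?fsvalP. Qed.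

Definition extend x phi (d : int) := update phi x (height phi (par x) + d).

(** Vertices not yet explored carry the filler height [0], which makes the enumeration free of
    repetitions. *)
Fixpoint homs (ks : seq int) (r : seq V) : seq {ffun D -> int} :=
  if r is x :: r' then
    [seq extend x phi d | phi <- homs ks r', d <- [:: 1; -1]]
  else map root_only ks.

Lemma mem_homs ks r phi : exploration r -> {subset r <= D} ->
  phi \in homs ks r <->
  [/\ height phi v \in ks,
      forall x, x \in r -> `|height phi x - height phi (par x)| = 1 &
      forall z, z \in D -> z \notin v :: r -> height phi z = 0].
Proof.
elim: r phi => [|x r IH] phi.
  move=> _ _; split=> [/mapP[k kk ->]|[hk _ h0]].
    split=> // [|z zD]; rewrite height_root_only ?eqxx //.
    by rewrite inE => /negPf ->.
  apply/mapP; exists (height phi v) => //; apply: height_ext => z zD.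
  by rewrite height_root_only; case: eqP => [->//|/eqP zv]; rewrite h0 // inE.
move=> /and4P[xv xr px er] sub.
have xD : x \in D by apply: sub; rewrite mem_head.
have subr : {subset r <= D} by move=> z zr; apply: sub; rewrite in_cons zr orbT.
have pxx : par x != x.
  by apply/eqP => E; move: px; rewrite E in_cons (negPf xv) (negPf xr).
have xvr : x \notin v :: r by rewrite in_cons negb_or xv.
have neq z : z \in v :: r -> (z == x) = false by move=> zr; apply: contraNF xvr => /eqP <-.
split=> [/allpairsP[[psi d] /= [/IH-/(_ er subr)[h1 h2 h3] dd ->]]|[h1 h2 h3]].
  split.
  - by rewrite height_update // neq ?mem_head.
  - move=> z; rewrite in_cons !height_update // => /predU1P[->|zr].
      rewrite eqxx (negPf pxx) addrAC subrr add0r.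
      by move: dd; rewrite !inE => /orP[]/eqP ->.
    by rewrite !neq ?exploration_parent // ?h2 // in_cons zr orbT.
  - move=> z zD; rewrite !in_cons !negb_or => /and3P[zv zx zr].
    by rewrite height_update // (negPf zx) h3 // in_cons negb_or zv.
pose psi := update phi x 0; pose d := height phi x - height phi (par x).
have -> : phi = extend x psi d.
  apply: height_ext => z zD; rewrite !height_update // (negPf pxx) addrC subrK.
  by case: eqP => [->|].
apply: (allpairs_f (extend x)).
  apply/IH => //; split.
  - by rewrite height_update // neq ?mem_head.
  - move=> z zr; rewrite !height_update // !neq ?exploration_parent // ?in_cons ?zr ?orbT //.
    by rewrite h2 // in_cons zr orbT.
  - move=> z zD zr; rewrite height_update //; case: eqP => // /eqP zx.
    by rewrite h3 // !in_cons; move: zr; rewrite in_cons !negb_or zx => /andP[-> ->].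
have := h2 x (mem_head _ _); rewrite -/d !inE => d1.
by have [d0|d0] := leP 0 d; move: d1; rewrite ?(ger0_norm d0) ?(ltr0_norm d0) => h;
  apply/orP; [left|right]; apply/eqP => //; rewrite -h opprK.
Qed.

Lemma homs_uniq ks r : uniq ks -> exploration r -> {subset r <= D} -> uniq (homs ks r).
Proof.
move=> uk; elim: r => [|x r IH].
  move=> _ _; rewrite map_inj_uniq // => k l kl.
  by have := height_root_only k v; rewrite kl height_root_only eqxx.
move=> er' sub; have /and4P[xv xr px er] := er'.
have xD : x \in D by apply: sub; rewrite mem_head.
have subr : {subset r <= D} by move=> z zr; apply: sub; rewrite in_cons zr orbT.
have xvr : x \notin v :: r by rewrite in_cons negb_or xv.
apply: allpairs_uniq; [exact: IH|by []|].
move=> u1 u2 /allpairsP[[q1 c1] [m1 _ ->]] /allpairsP[[q2 c2] [m2 _ ->]] /= E.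
have [_ _ z1] := (mem_homs ks q1 er subr).1 m1.
have [_ _ z2] := (mem_homs ks q2 er subr).1 m2.
have qq : q1 = q2.
  apply: height_ext => z zD; have [->|zx] := eqVneq z x; first by rewrite z1 ?z2.
  by have := congr1 (fun f => height f z) E; rewrite !height_update // (negPf zx).
move: E; rewrite qq => /(congr1 (fun f => height f x)).
by rewrite !height_update // eqxx => /addrI ->.
Qed.

Lemma prod_seq_scale (T : eqType) (s : seq T) (p : T) (a : T -> R) (c : R) :
  uniq s -> p \in s ->
  \prod_(z <- s) (if z == p then a z * c else a z) = (\prod_(z <- s) a z) * c.
Proof.
move=> us ps; rewrite (bigD1_seq p) //= eqxx [in RHS](bigD1_seq p) //= mulrAC.
by congr (_ * _ * _); apply: eq_bigr => z /negPf ->.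
Qed.

(** Summing over the two heights allowed for the last explored vertex replaces its weight by
    [nbr_sum] at the height of its parent, where [eliminate] records it. *)
Lemma sum_homs (w : V -> nat -> R) ks r : exploration r -> {subset r <= D} ->
  \sum_(phi <- homs ks r) \prod_(z <- v :: r) w z `|height phi z|%N =
  \sum_(k <- ks) eliminate w r `|k|%N.
Proof.
elim: r w => [|x r IH] w.
  move=> _ _; rewrite big_map; apply: eq_bigr => k _.
  by rewrite big_seq1 height_root_only eqxx.
move=> er' sub; have /and4P[xv xr px er] := er'.
have xD : x \in D by apply: sub; rewrite mem_head.
have subr : {subset r <= D} by move=> z zr; apply: sub; rewrite in_cons zr orbT.
have xvr : x \notin v :: r by rewrite in_cons negb_or xv.
rewrite -IH // [homs _ _]/(allpairs (extend x) (homs ks r) [:: 1; -1]).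
rewrite big_allpairs_dep; apply: eq_bigr => phi _.
have two (G : int -> R) : \sum_(d <- [:: 1; -1]) G d = G 1 + G (-1).
  by rewrite big_cons big_seq1.
rewrite two.
have step d : \prod_(z <- [:: v, x & r]) w z `|height (extend x phi d) z|%N
   = (\prod_(z <- v :: r) w z `|height phi z|%N) * w x `|(height phi (par x) + d)%R|%N.
  rewrite (perm_big (x :: v :: r)) /=; last by rewrite (perm_catCA [:: v] [:: x]).
  rewrite big_cons height_update // eqxx mulrC; congr (_ * _).
  rewrite [LHS]big_seq [RHS]big_seq; apply: eq_bigr => z zr.
  by rewrite height_update //; case: eqP => // zx; rewrite -zx zr in xvr.
rewrite !step -mulrDr nbr_sum_absz -(prod_seq_scale _ _ (exploration_uniq er) px).
by apply: eq_bigr => z _; case: eqP => [->|].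
Qed.

End Domain.
End Counting.

(** * Homomorphisms on a domain counted by weights *)

Section DomainCount.
Variables (R : realType) (V : choiceType) (e : rel V).
Hypotheses (Vinf : infinite_set [set: V]) (Vlf : locally_finite e) (Vtree : is_tree e).
Variables (v : V) (L : {fset V}).
Hypotheses (vL : v \in L) (Lconn : connected_in e L).

Local Notation depth := (dist e v).
Local Notation par := (parent e v).
Local Notation D := (closed_domain e L).
Local Notation H := (zero_boundary_homs e L).

Lemma root_in_domain : v \in D.
Proof. by rewrite in_domain vL. Qed.

(** A parent is strictly closer to the root, so decreasing depth puts every vertex before its
    parent. *)
Lemma exploration_sorted s : sorted (fun a b => (depth b <= depth a)%N) s ->
  uniq s -> (forall x, x \in s -> x != v /\ par x \in v :: s) -> exploration e v s.
Proof.
elim: s => // x s IH pxs; rewrite cons_uniq => /andP[xs us] sv.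
have tr : transitive (fun a b => (depth b <= depth a)%N).
  by move=> b a c ba cb; exact: leq_trans cb ba.
have /allP min := order_path_min tr (pxs : path _ x s).
have [xv px] := sv x (mem_head _ _).
apply/and4P; split=> //.
  move: px; rewrite !in_cons => /or3P[->//|/eqP E|->]; rewrite ?orbT //.
  by have := parent_neq Vtree xv; rewrite E eqxx.
apply: IH => [||y ys]; [exact: path_sorted pxs|exact: us|].
have [yv py] : y != v /\ par y \in [:: v, x & s] by apply: sv; rewrite in_cons ys orbT.
split=> //; move: py; rewrite !in_cons => /or3P[->//|/eqP E|->]; rewrite ?orbT //.
have [_ dy] := parentP Vtree yv; have := min y ys.
by rewrite -dy E ltnn.
Qed.

Lemma exists_exploration : exists r, [/\ exploration e v r, {subset r <= D} &
  forall x, x \in D -> x \in v :: r].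
Proof.
pose r := sort (fun a b => (depth b <= depth a)%N) [seq x <- D | x != v].
have rE x : (x \in r) = (x != v) && (x \in D) by rewrite mem_sort mem_filter.
exists r; split.
- apply: exploration_sorted.
  + by apply: sort_sorted => a b; exact: leq_total.
  + by rewrite sort_uniq filter_uniq // fset_uniq.
  + move=> x; rewrite rE => /andP[xv xD]; split=> //.
    rewrite in_cons rE; case: eqP => //= _.
    by rewrite in_domain (parent_in_domain Vlf Vtree vL Lconn).
- by move=> x; rewrite rE => /andP[].
- by move=> x xD; rewrite in_cons rE xD andbT orbN.
Qed.

(** Otherwise [L] would be closed under adjacency, hence all of [V], which is infinite. *)
Lemma boundary_neq0 : exists x, x \in boundary e L.
Proof.
apply: contrapT => /forallNP noB; apply: Vinf.
apply: (@sub_finite_set _ _ [set` L]); last exact: finite_fset.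
move=> x _ /=; have [_ ec _] := Vtree; have [p [pp <-]] := ec v x.
elim: p v vL pp => //= y p IH z zL /andP[zy pp]; apply: IH pp.
have := nbrs_in_domain Vlf zL zy; rewrite in_domain => /orP[//|/noB[]].
Qed.

Lemma hom_height_bound phi x : H phi -> x \in D ->
  (`|height phi v| <= `|height phi x| + depth x)%N.
Proof.
move=> [hom _]; have [n] := ubnP (depth x); elim: n x => // n IH x xn xD.
have [->|xv] := eqVneq x v; first exact: leq_addr.
have [ep dp] := parentP Vtree xv.
have pD : par x \in D by rewrite in_domain (parent_in_domain Vlf Vtree vL Lconn xD).
have {IH} := IH (par x); rewrite -ltnS dp => /(_ xn pD) h.
have := hom [` xD]%fset [` pD]%fset ep; rewrite -!heightE /= => h1.
by apply: leq_trans h _; rewrite -dp addnS -addSn leq_add2r; lia.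
Qed.

Definition initial_weight (z : V) (k : nat) : R :=
  if z \in boundary e L then (k == 0%N)%:R else 1.

Lemma count_sum (T : Type) (a : pred T) (s : seq T) :
  (count a s)%:R = \sum_(x <- s) (a x)%:R :> R.
Proof. by elim: s => [|x s IH]; rewrite ?big_nil ?big_cons //= natrD IH. Qed.

Lemma prod_bool (T : Type) (a : pred T) (s : seq T) :
  \prod_(x <- s) (a x)%:R = (all a s)%:R :> R.
Proof.
by elim: s => [|x s IH]; rewrite ?big_nil ?big_cons //= IH -natrM mulnb.
Qed.

Lemma card_fset_set_seq (T : choiceType) (A : set T) (s : seq T) : uniq s ->
  (forall x, A x <-> x \in s) -> #|` fset_set A| = size s.
Proof.
move=> us As; have -> : A = [set` [fset x in s]%fset].
  by apply/seteqP; split=> x /=; rewrite inE => /As.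
by rewrite set_fsetK card_fseq undup_id.
Qed.

(** The product of the initial weights is [1] on maps that vanish on the boundary and [0] on the
    others, so the weighted sum of [sum_homs] is a cardinality. *)
Lemma card_homs r N (b : pred nat) : exploration e v r -> {subset r <= D} ->
  (forall x, x \in D -> x \in v :: r) -> (forall phi, H phi -> (`|height phi v| < N)%N) ->
  (#|` fset_set (H `&` [set phi : {ffun D -> int} | b `|height phi v|%N])|)%:R =
  \sum_(j < N) two_sided R j * ((b j)%:R * eliminate e v initial_weight r j) :> R.
Proof.
move=> er rD Dr HN; have vD := root_in_domain.
pose ks := [seq k <- ints N | b `|k|%N].
pose zero (phi : {ffun D -> int}) :=
  all (fun z => (z \in boundary e L) ==> (height phi z == 0)) (v :: r).
have uks : uniq ks by rewrite filter_uniq ?uniq_ints.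
have ur := homs_uniq vD uks er rD.
rewrite (@card_fset_set_seq _ _ [seq phi <- homs e v D ks r | zero phi]); first last.
- move=> phi; rewrite mem_filter; split=> [[Hphi bphi]|/andP[/allP z0 /(mem_homs vD ks _ er rD)[h1 h2 h3]]].
    have [hom z0] := Hphi; apply/andP; split.
      apply/allP => z zr; apply/implyP => zB; apply/eqP.
      have zD : z \in D by rewrite in_domain zB orbT.
      by rewrite -[z]/(val [` zD]%fset) heightE z0.
    apply/(mem_homs vD ks _ er rD); split.
    + by rewrite mem_filter bphi mem_ints HN.
    + move=> x xr; have xD := rD _ xr.
      have pD : par x \in D by rewrite in_domain (parent_in_domain Vlf Vtree vL Lconn xD).
      have xv : x != v by apply: contraNneq (exploration_notin er) => <-.
      have [ep _] := parentP Vtree xv.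
      by have := hom [` xD]%fset [` pD]%fset ep; rewrite -!heightE.
    + by move=> z /Dr zr; rewrite zr.
  have hE (u w : D) : val w = par (val u) -> e (val u) (val w) -> `|phi u - phi w| = 1.
    move=> wE uw; rewrite -!heightE wE; apply: h2.
    have /= := Dr (val u) (fsvalP u); rewrite in_cons => /predU1P[uv|//].
    by move: uw; rewrite wE (uv : val u = v) parent_root (edge_irr Vtree).
  split; last by move: h1; rewrite mem_filter => /andP[].
  split=> [u w uw|u uB].
    have [E|E] := edge_parent Vtree v uw; first exact: hE.
    by rewrite distrC; apply: hE => //; rewrite edge_sym.
  have /implyP/(_ uB)/eqP := z0 _ (Dr _ (fsvalP u)).
  by rewrite heightE.
- by rewrite filter_uniq.
rewrite size_filter count_sum.
have pz phi : (zero phi)%:R = \prod_(z <- v :: r) initial_weight z `|height phi z|%N.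
  rewrite -prod_bool; apply: eq_bigr => z _; rewrite /initial_weight absz_eq0.
  by case: (z \in _).
under eq_bigr do rewrite pz.
rewrite sum_homs // /ks big_filter big_mkcond /=.
rewrite -(sum_ints (fun j => (b j)%:R * eliminate e v initial_weight r j)).
by apply: eq_bigr => k _; case: (b _); rewrite ?mul1r ?mul0r.
Qed.

(** Up to the factor [two_sided R j], the value at [j] counts the homomorphisms of height [j] or
    [- j] at the root, and there are none. *)
Lemma eliminate_eq0 r N j : exploration e v r -> {subset r <= D} ->
  (forall x, x \in D -> x \in v :: r) -> (forall phi, H phi -> (`|height phi v| < N)%N) ->
  (N <= j)%N -> eliminate e v initial_weight r j = 0.
Proof.
move=> er rD Dr HN Nj.
have HN' phi : H phi -> (`|height phi v| < j.+1)%N by move=> /HN h; rewrite ltnS ltnW // (leq_trans h).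
have := card_homs (pred1 j) er rD Dr HN'.
have -> : H `&` [set phi : {ffun D -> int} | pred1 j `|height phi v|%N] = set0.
  apply/seteqP; split=> // phi [/HN h /eqP E]; move: h; rewrite E ltnNge Nj //.
rewrite fset_set0 cardfs0 big_ord_recr /= eqxx mul1r big1 => [|i _]; last first.
  by rewrite ltn_eqF ?mul0r ?mulr0.
by rewrite add0r => /esym/eqP; rewrite mulf_eq0 gt_eqF ?two_sided_gt0 // => /eqP.
Qed.

End DomainCount.

(** * Bounds propagated through the elimination *)

Section Elimination.
Variables (R : realType) (V : choiceType) (e : rel V).
Hypotheses (Vinf : infinite_set [set: V]) (Vlf : locally_finite e) (Vtree : is_tree e).
Variables (v : V) (L : {fset V}).
Hypotheses (vL : v \in L) (Lconn : connected_in e L).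

Local Notation depth := (dist e v).
Local Notation par := (parent e v).
Local Notation D := (closed_domain e L).
Local Notation H := (zero_boundary_homs e L).

(** An abstraction of [spread] and [decay]: [s x] is the constant of the factor that [x] passes to
    its parent. *)
Variables (good : (nat -> R) -> R -> Prop) (s : V -> R).
Hypothesis good1 : good (fun=> 1) 0.
Hypothesis goodM : forall f g a b,
  good f a -> good g b -> good (fun k => f k * g k) (a + b).
Hypothesis good_interior : forall x, x \in L -> x != v -> forall f,
  good f (\sum_(y <- nbrs e x | y != par x) s y) -> good (nbr_sum f) (s x).
Hypothesis good_boundary : forall x, x \in boundary e L ->
  good (nbr_sum (fun k => (k == 0%N)%:R)) (s x).

(** The invariant: the current weight of a remaining vertex of [L] has as constant the sum of [s]
    over its children already eliminated, those not in [r]. *)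
Lemma good_eliminate_aux r (w : V -> nat -> R) :
  exploration e v r -> {subset r <= D} ->
  (forall z, z \in boundary e L -> w z = fun k => (k == 0%N)%:R) ->
  (forall z, z \in L -> z \in v :: r ->
    good (w z) (\sum_(y <- nbrs e z | (y != par z) && (y \notin r)) s y)) ->
  good (eliminate e v w r) (\sum_(y <- nbrs e v) s y).
Proof.
elim: r w => [|x r IH] w.
  move=> _ _ _ /(_ v vL (mem_head _ _)) /=.
  rewrite big_seq_cond [in X in _ -> X]big_seq (eq_bigl (fun y => y \in nbrs e v)) // => y.
  rewrite in_nbrs // parent_root andbT.
  by have [vy|//] := boolP (e v y); apply: contraTneq vy => ->; rewrite edge_irr.
move=> /and4P[xv xr px er] sub wB wL.
have xD : x \in D by apply: sub; rewrite mem_head.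
have subr : {subset r <= D} by move=> z zr; apply: sub; rewrite in_cons zr orbT.
have xvr : x \notin v :: r by rewrite in_cons negb_or xv.
have pL := parent_in_domain Vlf Vtree vL Lconn xD.
have [epx xpp] := child_edge Vtree xv.
have gx : good (nbr_sum (w x)) (s x).
  move: (xD); rewrite in_domain => /orP[xL|xB]; last by rewrite wB //; exact: good_boundary.
  apply: good_interior => //; have := wL x xL; rewrite !in_cons eqxx orbT => /(_ isT).
  rewrite big_seq_cond [in X in _ -> X]big_seq_cond.
  congr good; apply: eq_bigl => y; rewrite in_nbrs //.
  have [xy /=|//] := boolP (e x y); have [//|yx /=] := eqVneq y (par x).
  have [_ py] := child_parent Vtree xy yx.
  rewrite in_cons negb_or; apply/andP; split.
    by apply: contraTneq xy => ->; rewrite edge_irr.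
  by apply: contraNN xvr => yr; rewrite -py; exact: exploration_parent.
apply: IH => // [z zB|z zL zr].
  by case: eqP => [zp|_]; [move: zB; rewrite zp in_boundary // pL|exact: wB].
have {}wL := wL z zL; have zr' : z \in [:: v, x & r].
  by move: zr; rewrite !in_cons => /orP[->|->]; rewrite ?orbT.
have {wL} := wL zr'; case: eqP => [zp|/eqP zp].
  move=> gz; have := goodM gz gx; congr good.
  rewrite -zp in epx xpp *.
  rewrite [in LHS]big_mkcond [RHS]big_mkcond /=.
  rewrite !(bigD1_seq x) ?fset_uniq ?in_nbrs //= xpp mem_head andbF xr add0r addrC.
  by congr (_ + _); apply: eq_bigr => y /negPf yx; rewrite in_cons yx.
rewrite big_seq_cond [in X in _ -> X]big_seq_cond.
congr good; apply: eq_bigl => y; rewrite in_nbrs //.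
have [zy /=|//] := boolP (e z y); have [//|yz /=] := eqVneq y (par z).
have [_ py] := child_parent Vtree zy yz.
rewrite in_cons negb_or; have [yx|//] := eqVneq y x.
by rewrite -yx py eqxx in zp.
Qed.

Lemma good_eliminate r : exploration e v r -> {subset r <= D} ->
  (forall x, x \in D -> x \in v :: r) ->
  good (eliminate e v (initial_weight R e L) r) (\sum_(y <- nbrs e v) s y).
Proof.
move=> er rD Dr; apply: good_eliminate_aux => // [z zB|z zL _].
  by rewrite /initial_weight zB.
rewrite big_seq_cond big1.
  rewrite (_ : initial_weight _ _ _ _ = fun=> 1) //; apply/funext => k.
  by rewrite /initial_weight in_boundary // zL.
move=> y /and3P[zy yz /negP[]]; rewrite in_nbrs // in zy.
have [yv _] := child_parent Vtree zy yz.
have := Dr y (nbrs_in_domain Vlf zL zy).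
by rewrite in_cons (negPf yv).
Qed.

Lemma height_prob_lt (b : pred nat) (B : set int) (eps : R) : 0 < eps ->
  (forall z : int, B z <-> b `|z|%N) ->
  (forall f N, good f (\sum_(y <- nbrs e v) s y) ->
    (forall j, (N <= j)%N -> f j = 0) ->
    \sum_(j < N) two_sided R j * ((b j)%:R * f j) <=
    eps / 2 * \sum_(j < N) two_sided R j * f j) ->
  height_prob R e L v B < eps.
Proof.
move=> e0 Bb small.
have [r [er rD Dr]] := exists_exploration Vlf Vtree vL Lconn.
have [x xB] := boundary_neq0 Vinf Vlf Vtree vL.
pose N := (depth x).+1.
have HN phi : H phi -> (`|height phi v| < N)%N.
  move=> Hphi; have xD : x \in D by rewrite in_domain xB orbT.
  have := hom_height_bound Vlf Vtree vL Lconn Hphi xD.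
  rewrite (heightE phi [` xD]%fset : height phi x = _).
  by have [_ ->] := Hphi; rewrite ?ltnS.
pose EB := [set phi : {ffun D -> int} | b `|height phi v|%N].
have BE : [set phi : {ffun D -> int} | B (height phi v)] = EB.
  by apply/seteqP; split=> phi /Bb.
have HT : H = H `&` [set phi : {ffun D -> int} | predT `|height phi v|%N].
  by apply/seteqP; split=> phi // [].
rewrite /height_prob BE /uniform_prob.
have SE := card_homs R Vlf Vtree vL Lconn predT er rD Dr HN; rewrite -HT in SE.
have TE := card_homs R Vlf Vtree vL Lconn b er rD Dr HN.
pose cT := #|` fset_set (H `&` EB)|; pose cS := #|` fset_set H|.
pose F := eliminate e v (initial_weight R e L) r.
rewrite -/cS -/F in SE; rewrite -/EB -/cT -/F in TE.
suff : cT%:R / cS%:R < eps by [].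
have {}SE : cS%:R = \sum_(j < N) two_sided R j * F j.
  by rewrite SE; apply: eq_bigr => j _; rewrite mul1r.
have := small F N (good_eliminate er rD Dr)
  (fun j => eliminate_eq0 R Vlf Vtree vL Lconn er rD Dr HN).
(* The probability is a quotient by the number of homomorphisms, which is [0] by convention if that
   number is; [eps / 2] leaves room for the strict inequality. *)
rewrite -TE -SE => ST; have [->|cS0] := posnP cS; first by rewrite invr0 mulr0.
have cS1 : 0 < cS%:R :> R by rewrite ltr0n.
rewrite ltr_pdivrMr // (le_lt_trans ST) // ltr_pM2r //; lra.
Qed.

End Elimination.

(** * Random walk and conductances *)

Lemma cvg_sum_seq (R : realType) (I : Type) (r : seq I) (P : pred I)
    (g : nat -> I -> R) (h : I -> R) :
  (forall y, g n y @[n --> \oo] --> h y) ->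
  \sum_(y <- r | P y) g n y @[n --> \oo] --> \sum_(y <- r | P y) h y.
Proof.
move=> gh; apply: (@cvg_big R I +%R 0 P _ nat \oo r (fun y n => g n y) h) => //.
exact: add_continuous.
Qed.

Section Walk.
Variables (R : realType) (V : choiceType) (e : rel V).
Hypotheses (Vinf : infinite_set [set: V]) (Vlf : locally_finite e) (Vtree : is_tree e).
Implicit Types (g h : V -> R).

Definition avg g (x : V) : R := (#|` nbrs e x|)%:R^-1 * \sum_(y <- nbrs e x) g y.

Lemma deg_gt0 x : 0 < (#|` nbrs e x|)%:R :> R.
Proof. by rewrite ltr0n nbrs_neq0. Qed.

Lemma ler_avg g h x : (forall y, g y <= h y) -> avg g x <= avg h x.
Proof.
by move=> gh; rewrite ler_pM2l ?invr_gt0 ?deg_gt0 // ler_sum.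
Qed.

Lemma avg_const c x : avg (fun=> c) x = c.
Proof.
rewrite /avg big_const_seq count_predT iter_addr_0 -[c *+ _]mulr_natl.
by rewrite mulKf // gt_eqF ?deg_gt0.
Qed.

Lemma avgB g h x : avg (fun y => g y - h y) x = avg g x - avg h x.
Proof. by rewrite /avg sumrB mulrBr. Qed.

Lemma avg_ge0_eq0 g x : (forall y, 0 <= g y) -> avg g x <= 0 ->
  forall y, e x y -> g y = 0.
Proof.
move=> g0; rewrite /avg pmulr_rle0 ?invr_gt0 ?deg_gt0 // => s0 y xy.
have /eqP : \sum_(y <- nbrs e x) g y = 0.
  by apply/le_anti; rewrite s0 sumr_ge0.
rewrite psumr_eq0 // => /allP /(_ y); rewrite in_nbrs // => /(_ xy) /=.
by move/eqP.
Qed.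

Lemma zero_set_connected g o : g o = 0 ->
  (forall x y, g x = 0 -> e x y -> g y = 0) -> forall x, g x = 0.
Proof.
move=> go step x; have [_ ec _] := Vtree; have [p [pp <-]] := ec o x.
by elim: p o go pp => //= y p IH z gz /andP[/(step _ _ gz)]; exact: IH.
Qed.

Lemma cvg_avg (g : nat -> V -> R) h x : (forall y, g n y @[n --> \oo] --> h y) ->
  avg (g n) x @[n --> \oo] --> avg h x.
Proof.
by move=> gh; apply: cvgMl_tmp; exact: cvg_sum_seq.
Qed.

Lemma eq_srw_prob n x (E E' : pred (seq V)) : E =1 E' ->
  srw_prob R e n x E = srw_prob R e n x E'.
Proof.
elim: n x E E' => [|n IH] x E E' EE /=; first by rewrite EE.
by congr (_ * _); apply: eq_bigr => y _; apply: IH => w; exact: EE.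
Qed.

Lemma srw_prob_true n x : srw_prob R e n x predT = 1.
Proof.
elim: n x => //= n IH x; rewrite -[RHS](avg_const 1 x); congr (_ * _).
by apply: eq_bigr => y _; rewrite -[RHS](IH y); apply: eq_srw_prob.
Qed.

Section Target.
Variable o : V.

(** Only times [1] to [n] count here; [hit_by] also counts time [0]. *)
Definition visit (n : nat) (x : V) : R := srw_prob R e n x (fun w => o \in w).
Definition hit_by (n : nat) (x : V) : R := if x == o then 1 else visit n x.

Lemma visitS n x : visit n.+1 x = avg (hit_by n) x.
Proof.
rewrite /visit /avg /=; congr (_ * _); apply: eq_bigr => y _.
rewrite /hit_by eq_sym; case: eqVneq => [->|oy].
  by rewrite -(srw_prob_true n y); apply: eq_srw_prob => w; rewrite in_cons eqxx.
by apply: eq_srw_prob => w; rewrite in_cons (negPf oy).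
Qed.

Lemma visit_bounds n x : 0 <= visit n x <= 1.
Proof.
elim: n x => [|n IH] x; first by rewrite /visit /= lexx ler01.
rewrite visitS; apply/andP; split.
  rewrite -[X in X <= _](avg_const 0 x); apply: ler_avg => y.
  by rewrite /hit_by; case: eqP => // _; case/andP: (IH y).
rewrite -[X in _ <= X](avg_const 1 x); apply: ler_avg => y.
by rewrite /hit_by; case: eqP => // _; case/andP: (IH y).
Qed.

Lemma visit_succ n x : visit n x <= visit n.+1 x.
Proof.
elim: n x => [|n IH] x; first by have /andP[] := visit_bounds 1 x.
rewrite !visitS; apply: ler_avg => y; rewrite /hit_by.
by case: eqP.
Qed.

Lemma cvg_visit x : cvgn (visit ^~ x).
Proof.
apply: nondecreasing_is_cvgn; first by apply/nondecreasing_seqP => n; exact: visit_succ.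
by exists 1 => _ [n _ <-]; have /andP[] := visit_bounds n x.
Qed.

Definition hit (x : V) : R := if x == o then 1 else limn (visit ^~ x).

Lemma cvg_hit_by x : hit_by n x @[n --> \oo] --> hit x.
Proof.
rewrite /hit_by /hit; case: eqP => _; first exact: cvg_cst.
exact: cvg_visit.
Qed.

Lemma lim_visit x : limn (visit ^~ x) = avg hit x.
Proof.
apply/cvg_lim => //; rewrite -cvg_shiftS.
rewrite (_ : [sequence visit n.+1 x]_n = fun n => avg (hit_by n) x).
  by apply: cvg_avg => y; exact: cvg_hit_by.
by apply/funext => n; exact: visitS.
Qed.

Lemma return_probE : return_prob R e o = avg hit o.
Proof. exact: lim_visit. Qed.

Lemma hit_harmonic x : x != o -> hit x = avg hit x.
Proof. by move=> xo; rewrite -lim_visit /hit (negPf xo). Qed.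

Lemma hit_target : hit o = 1.
Proof. by rewrite /hit eqxx. Qed.

Lemma hit_bounds x : 0 <= hit x <= 1.
Proof.
rewrite /hit; case: eqP => _; first by rewrite ler01 lexx.
have c := @cvg_visit x; apply/andP; split.
  by apply: limr_ge => //; near=> n; have /andP[] := visit_bounds n x.
by apply: limr_le => //; near=> n; have /andP[] := visit_bounds n x.
Unshelve. all: by end_near. Qed.

(** Induction on the number of steps compares [hit_by n] with [g]; then [n] tends to infinity. *)
Lemma hit_minimal g : (forall x, 0 <= g x) -> 1 <= g o ->
  (forall x, x != o -> avg g x <= g x) -> forall x, hit x <= g x.
Proof.
move=> g0 go gs x.
have hg n y : hit_by n y <= g y.
  elim: n y => [|n IH] y; rewrite /hit_by; case: eqP => [->//|/eqP yo].
    by rewrite /visit /=.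
  by rewrite visitS; apply: le_trans (gs y yo); exact: ler_avg.
rewrite -(cvg_lim _ (@cvg_hit_by x)) //; apply: limr_le.
  by apply/cvg_ex; exists (hit x); exact: cvg_hit_by.
by near=> n; exact: hg.
Unshelve. all: by end_near. Qed.

(** By the minimum principle a zero of [hit] would spread along edges to [o], where the value is
    [1]. *)
Lemma hit_gt0 x : 0 < hit x.
Proof.
have h0 y : 0 <= hit y by have /andP[] := hit_bounds y.
rewrite lt_neqAle h0 andbT; apply/negP => /eqP/esym x0.
have : hit o = 0.
  apply: (zero_set_connected x0) => y z y0 yz.
  have yo : y != o by apply/eqP => yo; move/eqP: y0; rewrite yo hit_target oner_eq0.
  by apply: (avg_ge0_eq0 h0 _ yz); rewrite -hit_harmonic // y0.
by rewrite hit_target => /eqP; rewrite oner_eq0.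
Qed.

End Target.

(* If the walk surely returns to [o], the probability of hitting [v] is
   superharmonic and minimal at [o], hence constant. *)
Lemma recurrent_everywhere o v : 1 <= return_prob R e o -> 1 <= return_prob R e v.
Proof.
rewrite !return_probE => ro.
have b01 y : 0 <= 1 - hit o y by rewrite subr_ge0; have /andP[] := hit_bounds o y.
have b1 x : 1 - hit o x = 0.
  apply: (@zero_set_connected (fun x => 1 - hit o x) o) => [|y z y0 yz].
    by rewrite hit_target subrr.
  apply: (avg_ge0_eq0 b01 _ yz); rewrite avgB avg_const.
  have [->|yo] := eqVneq y o; first by rewrite subr_le0.
  by rewrite -hit_harmonic // y0.
have a0 x : 0 <= hit v x by have /andP[] := hit_bounds v x.
have sup x : avg (hit v) x <= hit v x.
  have [->|xv] := eqVneq x v; last by rewrite -hit_harmonic.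
  rewrite hit_target -[X in _ <= X](avg_const 1 v); apply: ler_avg => y.
  by have /andP[] := hit_bounds v y.
have ho := hit_gt0 v o.
have min x : 0 <= hit v x - hit v o.
  rewrite subr_ge0; have -> : hit v o = hit v o * hit o x.
    by move/eqP: (b1 x); rewrite subr_eq0 => /eqP <-; rewrite mulr1.
  rewrite mulrC -ler_pdivlMr //.
  apply: (@hit_minimal o (fun x => hit v x / hit v o)) => [y||y yo].
  - exact: divr_ge0 (a0 y) (ltW ho).
  - by rewrite divff ?gt_eqF.
  - rewrite /avg -mulr_suml mulrA ler_pM2r ?invr_gt0 //; exact: sup.
have eq x : hit v x - hit v o = 0.
  apply: (@zero_set_connected (fun x => hit v x - hit v o) o) => [|y z y0 yz].
    by rewrite subrr.
  apply: (avg_ge0_eq0 min _ yz); rewrite avgB avg_const.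
  by rewrite subr_le0 (le_trans (sup y)) // -subr_le0 y0.
have one x : hit v x = 1.
  by rewrite -[LHS](subrK (hit v o)) eq add0r -(hit_target v) -[RHS](subrK (hit v o)) eq add0r.
by rewrite (_ : hit v = fun=> 1) ?avg_const //; apply/funext.
Qed.

End Walk.

(** * Conductances and the two halves of the dichotomy *)

Section Dichotomy.
Variables (R : realType) (V : choiceType) (e : rel V).
Hypotheses (Vinf : infinite_set [set: V]) (Vlf : locally_finite e) (Vtree : is_tree e).

Lemma ratio_le (a b : R) : 0 <= a -> a <= b -> a / (1 + a) <= b / (1 + b).
Proof.
by move=> a0 ab; rewrite ler_pdivrMr ?ltr_wpDr // mulrAC ler_pdivlMr; lra.
Qed.

(* Effective conductance from [p] through its neighbour [x] down to [n]
   generations below, with unit conductances. *)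
Fixpoint conductance (n : nat) (p x : V) : R :=
  if n is m.+1 then
    let S := \sum_(y <- nbrs e x | y != p) conductance m x y in S / (1 + S)
  else 1.

Lemma conductance_bounds n p x : 0 <= conductance n p x <= 1.
Proof.
elim: n p x => [|n IH] p x /=; first by rewrite ler01 lexx.
set S := \sum_(_ <- _ | _) _.
have S0 : 0 <= S by apply: sumr_ge0 => y _; case/andP: (IH x y).
have S1 : 0 < 1 + S by lra.
by rewrite (divr_ge0 S0 (ltW S1)) ler_pdivrMr // mul1r; lra.
Qed.

Lemma conductance_decr n p x : conductance n.+1 p x <= conductance n p x.
Proof.
elim: n p x => [|n IH] p x; first by have /andP[] := conductance_bounds 1 p x.
rewrite [leLHS]/= [leRHS]/=; apply: ratio_le.
  by apply: sumr_ge0 => y _; have /andP[] := conductance_bounds n.+1 x y.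
by apply: ler_sum => y _; exact: IH.
Qed.

Definition conductance_lim (p x : V) : R := limn (fun n => conductance n p x).

Lemma cvg_conductance p x : conductance n p x @[n --> \oo] --> conductance_lim p x.
Proof.
apply: (@nonincreasing_is_cvgn R (fun n => conductance n p x)).
  by apply/nonincreasing_seqP => n; exact: conductance_decr.
by exists 0 => _ [n _ <-]; have /andP[] := conductance_bounds n p x.
Qed.

Lemma conductance_lim_ge0 p x : 0 <= conductance_lim p x.
Proof.
apply: limr_ge; first by apply/cvg_ex; exists (conductance_lim p x); exact: cvg_conductance.
by near=> n; have /andP[] := conductance_bounds n p x.
Unshelve. all: by end_near. Qed.

Lemma conductance_limE p x :
  let S := \sum_(y <- nbrs e x | y != p) conductance_lim x y in
  conductance_lim p x = S / (1 + S).
Proof.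
move=> S.
have S0 : 0 <= S by apply: sumr_ge0 => y _; exact: conductance_lim_ge0.
have S1 : 1 + S != 0 by rewrite gt_eqF //; lra.
apply/cvg_lim => //; rewrite -cvg_shiftS /=.
have cS : \sum_(y <- nbrs e x | y != p) conductance n x y @[n --> \oo] --> S.
  by apply: cvg_sum_seq => y; exact: cvg_conductance.
have cD : 1 + \sum_(y <- nbrs e x | y != p) conductance n x y @[n --> \oo] --> 1 + S.
  by apply: cvgD cS; exact: cvg_cst.
exact: cvgM cS (cvgV S1 cD).
Qed.

Section Rooted.
Variable v : V.
Local Notation depth := (dist e v).
Local Notation par := (parent e v).

Fixpoint ray_weight (n : nat) (x : V) : R :=
  if n is m.+1 then (1 - conductance_lim (par x) x) * ray_weight m (par x) else 1.

Lemma sum_nbrs_parent (g : V -> R) x : x != v ->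
  \sum_(y <- nbrs e x) g y = g (par x) + \sum_(y <- nbrs e x | y != par x) g y.
Proof.
by move=> xv; rewrite (bigD1_seq (par x)) ?in_nbrs ?fset_uniq //; have [] := parentP Vtree xv.
Qed.

(* The products of [1 - conductance] along rays form a harmonic function off
   [v], which dominates the probability of hitting [v]. *)
Lemma hit_le_ray_weight x : hit R e v x <= ray_weight (depth x) x.
Proof.
pose a x := ray_weight (depth x) x.
pose S x := \sum_(y <- nbrs e x | y != par x) conductance_lim x y.
have S0 z : 0 <= S z by apply: sumr_ge0 => y _; exact: conductance_lim_ge0.
have q1 z : 1 - conductance_lim (par z) z = (1 + S z)^-1.
  rewrite conductance_limE -/(S z); have := S0 z => Sz.
  by field; rewrite gt_eqF //; lra.
have aE z : z != v -> a z = (1 + S z)^-1 * a (par z).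
  by move=> /(parentP Vtree)[_ dz]; rewrite /a -dz /= q1.
have w0 n z : 0 <= ray_weight n z.
  elim: n z => //= n IH z; apply: mulr_ge0 (IH _).
  by rewrite q1 invr_ge0; have := S0 z; lra.
have a0 z : 0 <= a z by exact: w0.
apply: (hit_minimal Vinf Vlf Vtree a0) => [|z zv]; first by rewrite /a dist_self.
have S1 : 1 + S z != 0 by rewrite gt_eqF //; have := S0 z; lra.
have pz : a (par z) = (1 + S z) * a z by rewrite (aE z zv) mulVKf.
rewrite /avg ler_pdivrMl ?deg_gt0 // sum_nbrs_parent // pz.
have -> : \sum_(y <- nbrs e z | y != par z) a y =
    \sum_(y <- nbrs e z | y != par z) (1 - conductance_lim z y) * a z.
  rewrite big_seq_cond [RHS]big_seq_cond; apply: eq_bigr => y /andP[zy yz].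
  rewrite in_nbrs // in zy; have [yv py] := child_parent Vtree zy yz.
  by rewrite aE // -q1 py.
rewrite -mulr_suml sumrB -/(S z).
have -> : (#|` nbrs e z|)%:R = 1 + \sum_(y <- nbrs e z | y != par z) 1 :> R.
  have := sum_nbrs_parent (fun=> 1) zv.
  by rewrite big_const_seq count_predT iter_addr_0 => <-.
by apply: eq_imp_le; ring.
Qed.

(** Recurrence forces [hit] to equal [1] at each neighbour [y] of [v], while [hit_le_ray_weight]
    bounds it there by [1 - conductance_lim v y]. *)
Lemma recurrent_conductance_lim : 1 <= return_prob R e v ->
  \sum_(y <- nbrs e v) conductance_lim v y = 0.
Proof.
rewrite return_probE // => rv.
have q0 y := conductance_lim_ge0 v y.
rewrite big_seq big1 // => y vy; rewrite in_nbrs // in vy.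
have h1 z : 0 <= 1 - hit R e v z by rewrite subr_ge0; have /andP[] := hit_bounds R Vinf Vlf Vtree v z.
have yz : 1 - hit R e v y = 0.
  apply: (avg_ge0_eq0 Vinf Vlf Vtree h1 _ vy).
  by rewrite avgB avg_const // subr_le0.
have yv : y != v by apply: contraTneq vy => ->; rewrite edge_irr.
have [_ py] : y != v /\ par y = v.
  by apply: (child_parent Vtree vy); rewrite parent_root.
have := hit_le_ray_weight y; have [_ dy] := parentP Vtree yv.
rewrite py dist_self // in dy; rewrite -dy [ray_weight _ _]/= mulr1 py => h2.
by apply/le_anti; rewrite q0 andbT; lra.
Qed.

End Rooted.

Lemma recurrent_delocalized : ~ transient R e -> delocalized R e.
Proof.
move=> /existsNP[z /negP]; rewrite -leNgt => rz v A A0 eps e0.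
have rv := recurrent_everywhere Vinf Vlf Vtree v rz.
have e2 : 0 < eps / 2 by rewrite divr_gt0.
have [d d0 thin] := spread_thin (Num.truncn A) e2.
have c0 : \sum_(y <- nbrs e v) conductance n v y @[n --> \oo] -->
    \sum_(y <- nbrs e v) conductance_lim v y.
  by apply: cvg_sum_seq => y; exact: cvg_conductance.
rewrite recurrent_conductance_lim // in c0.
have /cvgr_le/(_ _ d0)[n _ /(_ n (leqnn n)) nd] := c0.
exists n.+1 => L [vL Lconn _] Ln.
(* The network is cut at depth [n + 1]; from there on the truncated subtraction gives conductance
   [1]. *)
pose s y := conductance (n.+1 - dist e v y) (parent e v y) y.
apply: (@height_prob_lt R V e Vinf Vlf Vtree v L vL Lconn (@spread R) s _ _ _ _
  (fun k => (k <= Num.truncn A)%N)) => //.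
- exact: spread_const.
- by move=> f g a b; exact: spread_mul.
- move=> x xL xv f Sf; have := spread_nbr_sum Sf.
  (* From the cut on, [s x = 1] only weakens the bound; above it the children have one level less
     and the recursion of [conductance] applies. *)
  case mE : (n.+1 - dist e v x)%N => [|m].
    have [S0 _ _ _] := Sf => /spread_weaken; apply.
    by rewrite /s mE /= ler_pdivrMr; lra.
  congr spread; rewrite /s mE /=.
  have sE : \sum_(y <- nbrs e x | y != parent e v x) s y =
      \sum_(y <- nbrs e x | y != parent e v x) conductance m x y.
    rewrite big_seq_cond [RHS]big_seq_cond; apply: eq_bigr => y /andP[xy yx].
    rewrite in_nbrs // in xy; have [yv py] := child_parent Vtree xy yx.
    have [_ dy] := parentP Vtree yv; rewrite py in dy.
    by rewrite /s py -dy subnS mE.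
  by rewrite -sE.
- move=> x xB; apply: spread_weaken (spread_nbr_sum (spread_delta R)) _.
  rewrite /s; have /eqP -> : (n.+1 - dist e v x == 0)%N by rewrite subn_eq0 Ln.
  by rewrite ler_pdivrMr //=; lra.
- move=> k /=; have -> : `|k|%:~R = `|k|%N%:R :> R by rewrite -abszE -pmulrn.
  by rewrite (truncn_ge_nat _ (ltW A0)).
- move=> f N Sf fN; apply: (thin f _ N Sf _ fN).
  apply: le_trans nd; apply: eq_imp_le; rewrite big_seq [RHS]big_seq.
  apply: eq_bigr => y vy; rewrite in_nbrs // in vy.
  have yv : y != v by apply: contraTneq vy => ->; rewrite edge_irr.
  have [_ py] : y != v /\ parent e v y = v.
    by apply: (child_parent Vtree vy); rewrite parent_root.
  have [_ dy] := parentP Vtree yv; rewrite py dist_self // in dy.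
  by rewrite /s py -dy subSS subn0.
Qed.

Lemma transient_localized : transient R e -> localized R e.
Proof.
move=> tr v eps e0; have e2 : 0 < eps / 2 by rewrite divr_gt0.
(* The positive part of the relative drop of the hitting probability from the parent to [y]; it
   plays the role of a conductance that does not depend on the domain. *)
pose t y := Num.max 0 (1 - hit R e v y / hit R e v (parent e v y)).
pose S x := \sum_(y <- nbrs e x | y != parent e v x) t y.
have h0 := hit_gt0 R Vinf Vlf Vtree v.
have t0 y : 0 <= t y by rewrite le_max lexx.
have t1 y : t y <= 1.
  by rewrite ge_max ler01 lerBlDr lerDl divr_ge0 // ltW.
have S0 x : 0 <= S x by exact: sumr_ge0.
(* Harmonicity at [x] writes the value of [hit] at the parent as [hit x] times [1] plus the relative
   drops to the children, hence as at most [hit x * (1 + S x)]. *)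
have tS x : x != v -> t x <= S x / (1 + S x).
  move=> xv; have S1 : 0 < 1 + S x by have := S0 x; lra.
  rewrite ge_max divr_ge0 ?S0 ?(ltW S1) //=.
  have hp := h0 (parent e v x); have hx := h0 x.
  have -> : S x / (1 + S x) = 1 - (1 + S x)^-1 by field; rewrite gt_eqF.
  rewrite lerD2l lerN2 ler_pdivlMr // ler_pdivrMl // mulrC.
  have := hit_harmonic R Vinf Vlf Vtree xv; rewrite /avg (sum_nbrs_parent _ xv) => hE.
  have {}hE : hit R e v x * (#|` nbrs e x|)%:R = hit R e v (parent e v x) +
      \sum_(y <- nbrs e x | y != parent e v x) hit R e v y.
    by rewrite hE mulrC mulrA divff ?mul1r // gt_eqF // deg_gt0.
  have dE : (#|` nbrs e x|)%:R = 1 + \sum_(y <- nbrs e x | y != parent e v x) 1 :> R.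
    have := sum_nbrs_parent (fun=> 1) xv.
    by rewrite big_const_seq count_predT iter_addr_0 => <-.
  have sE : \sum_(y <- nbrs e x | y != parent e v x) (hit R e v x - hit R e v y)
      <= hit R e v x * S x.
    rewrite mulr_sumr big_seq_cond [leRHS]big_seq_cond; apply: ler_sum => y /andP[xy yx].
    rewrite in_nbrs // in xy; have [yv py] := child_parent Vtree xy yx.
    apply: (@le_trans _ _ (hit R e v x * (1 - hit R e v y / hit R e v x))).
      by rewrite mulrBr mulr1 mulrCA divff ?mulr1 // gt_eqF.
    by rewrite ler_wpM2l ?(ltW hx) // /t py le_max lexx orbT.
  rewrite sumrB in sE.
  have cE : \sum_(y <- nbrs e x | y != parent e v x) hit R e v x =
      hit R e v x * \sum_(y <- nbrs e x | y != parent e v x) 1.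
    by rewrite mulr_sumr; apply: eq_bigr => y _; rewrite mulr1.
  rewrite cE in sE; rewrite dE in hE; lra.
(* If all these terms vanished, [hit] would be at least [1] on the neighbours of [v], against
   transience. *)
have root_gt0 : 0 < \sum_(y <- nbrs e v) t y / 3.
  rewrite lt_neqAle eq_sym sumr_ge0 => [|y _]; last by rewrite divr_ge0.
  rewrite andbT psumr_eq0 => [|y _]; last by rewrite divr_ge0.
  apply/negP => /allP z; have := tr v; rewrite return_probE // ltNge => /negP; apply.
  rewrite -[X in X <= _](avg_const Vinf Vlf Vtree 1 v) /avg.
  rewrite ler_pM2l ?invr_gt0 ?deg_gt0 // big_seq [leRHS]big_seq.
  apply: ler_sum => y vy; have /eqP := z y vy.
  move=> ty; have {}ty : t y = 0 by lra.
  rewrite in_nbrs // in vy.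
  have [yv py] : y != v /\ parent e v y = v.
    apply: (child_parent Vtree vy); rewrite parent_root.
    by apply: contraTneq vy => ->; rewrite edge_irr.
  have : 1 - hit R e v y / hit R e v (parent e v y) <= t y by rewrite le_max lexx orbT.
  by rewrite ty py hit_target divr1; lra.
have [M tail] := decay_tail root_gt0 e2.
exists [set z | z \in ints M]; split.
  by apply: (@sub_finite_set _ _ [set` [fset z in ints M]%fset]) => // z /=; rewrite inE.
move=> L [vL Lconn _].
apply: (@height_prob_lt R V e Vinf Vlf Vtree v L vL Lconn (@decay R) (fun y => t y / 3)
  _ _ _ _ (fun k => (M <= k)%N)) => //.
- exact: decay_const.
- by move=> f g a b; exact: decay_mul.
(* The factor [1 / 3] absorbs the [2] in [c / (1 + 2 * c)]: for [c = S / 3] this is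
   [S / (3 + 2 * S)], at least a third of [S / (1 + S)]. At the boundary, [c = 1] gives exactly
   [1 / 3]. *)
- move=> x xL xv f Sf; apply: decay_weaken (decay_nbr_sum Sf) _.
  rewrite divr_ge0 //= -mulr_suml -/(S x); have := tS x xv; have := S0 x => s0.
  have s1 : 0 < 1 + S x by lra.
  have s3 : 0 < 1 + 2 * (S x / 3) by lra.
  rewrite !ler_pdivlMr // => h; have := t0 x; have := mulr_ge0 (t0 x) s0; lra.
- move=> x xB; apply: decay_weaken (decay_nbr_sum (decay_delta R)) _.
  by rewrite divr_ge0 //= ler_pdivlMr; have := t1 x; lra.
- by move=> k; rewrite leqNgt -mem_ints; split=> [h|/negP]; [apply/negP|].
- by move=> f N Sf _; exact: tail.
Qed.

End Dichotomy.

Theorem theorem1p1 (R : realType) (V : choiceType) (e : rel V)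
    (Vinf : infinite_set [set: V]) (Vlf : locally_finite e)
    (Vtree : is_tree e) :
  (transient R e -> localized R e) /\ (~ transient R e -> delocalized R e).
Proof.
split; [exact: transient_localized|exact: recurrent_delocalized].
Qed.
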